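(* Let $p$ be a prime and $G=\mathbb{Z}\times\mathbb{Z}_p=\langle z\rangle\times\langle a\rangle$. Let $\mathcal{S}$ be a Schur ring over $G$, let $H$ be the maximal $\mathcal{S}$-subgroup contained in $\mathbb{Z}$, and write $T(\mathcal{S})=\mathcal{S}\cap F[\mathbb{Z}_p]=F[\mathbb{Z}_p]^{\mathcal{H}}$ with $\mathcal{H}\le\operatorname{Aut}(\mathbb{Z}_p)$ and $|\mathcal{H}|=m$. If there is an $\mathcal{S}$-class $C\subseteq G\setminus(H\times\mathbb{Z}_p)$ with $\gcd(|C|,m)=1$, then $\mathcal{S}$ is a wedge product or an automorphic Schur ring.
   Context: $F$ is a field of characteristic $0$; $\mathbb{Z}=\langle z\rangle$ infinite cyclic, $\mathbb{Z}_p=\langle a\rangle$ cyclic of order $p$, written multiplicatively. For finite $C\subseteq G$, $\overline{C}=\sum_{g\in C}g$ and $C^*=\{g^{-1}:g\in C\}$. A Schur ring over $G$ is a subspace $\mathcal{S}=\mathrm{Span}_F\{\overline{C}:C\in\mathcal{D}\}$ of $F[G]$, where $\mathcal{D}$ is a partition of $G$ into finite subsets with $\{1\}\in\mathcal{D}$, $C\in\mathcal{D}\Rightarrow C^*\in\mathcal{D}$, and each $\overline{C}\,\overline{D}$ a finite $F$-linear combination of the $\overline{E}$, $E\in\mathcal{D}$; members of $\mathcal{D}$ are $\mathcal{S}$-classes, an $\mathcal{S}$-subgroup is a subgroup that is a union of classes. $\mathbb{Z}_p$ is always an $\mathcal{S}$-subgroup, and every Schur ring over $\mathbb{Z}_p$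 is of the form $F[\mathbb{Z}_p]^{\mathcal{H}}$ (elements fixed by $\mathcal{H}$, classes the $\mathcal{H}$-orbits) for a subgroup $\mathcal{H}\le\operatorname{Aut}(\mathbb{Z}_p)$. $\mathcal{S}$ is automorphic if $\mathcal{S}=F[G]^{\mathcal{H}'}$ for some finite $\mathcal{H}'\le\operatorname{Aut}(G)$. $\mathcal{S}$ is a wedge product if there are nontrivial proper $\mathcal{S}$-subgroups $K\le L$ with $K$ normal such that every $\mathcal{S}$-class outside $L$ is a union of cosets of $K$. *)

(* Defs.v *)
From HB Require Import structures.
From mathcomp Require Import all_boot all_order all_algebra all_fingroup.
From mathcomp Require Import finmap.
Set Implicit Arguments. Unset Strict Implicit. Unset Printing Implicit Defensive.
Import GRing.Theory.
Local Open Scope fset_scope.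
Local Open Scope ring_scope.

(* The group G = Z x Z_p, written ADDITIVELY: z^n a^k  <->  (n, k),
   the identity 1 <-> 0, g^{-1} <-> -g, gh <-> g + h.
   The subgroup Z = <z> is {(n,0)}, the subgroup Z_p = <a> is {(0,k)}. *)
Definition G (p : nat) : Type := (int * 'Z_p)%type.

Section Defs.
Variables (p : nat) (F : fieldType).

(* Elements of the group algebra F[G] are finitely supported functions G -> F
   (the coefficient function of sum_g c_g g). *)
Definition finsupp (f : G p -> F) : Prop :=
  exists s : seq (G p), forall x, f x != 0 -> x \in s.

(* coefficient function of the class sum  \overline{C} *)
Definition csum (C : {fset G p}) : G p -> F := fun x => (x \in C)%:R.

Definition cprod (C D : {fset G p}) : G p -> F :=
  fun x => \sum_(c <- C) \sum_(d <- D) ((c + d == x) : bool)%:R.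

Definition cinv (C : {fset G p}) : {fset G p} := [fset - x | x in C].

Definition in_span (D : {fset G p} -> Prop) (f : G p -> F) : Prop :=
  exists l : seq ({fset G p} * F),
    (forall q, q \in l -> D q.1) /\
    forall x, f x = \sum_(q <- l) q.2 * csum q.1 x.

Definition schur_partition (D : {fset G p} -> Prop) : Prop :=
  [/\
      [/\ (forall C, D C -> C != fset0),
           (forall x, exists C, D C /\ x \in C) &
           (forall x C C', D C -> D C' -> x \in C -> x \in C' -> C = C')],
      D [fset (0 : G p)],
      (forall C, D C -> D (cinv C)) &
      (forall C E, D C -> D E -> in_span D (cprod C E))].

Definition schur_ring (D : {fset G p} -> Prop) : (G p -> F) -> Prop :=
  in_span D.

Definition is_subgroup (K : G p -> Prop) : Prop :=
  [/\ K 0, (forall x y, K x -> K y -> K (x + y)) & (forall x, K x -> K (- x))].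

Definition S_subgroup (D : {fset G p} -> Prop) (K : G p -> Prop) : Prop :=
  is_subgroup K /\
  forall C x y, D C -> x \in C -> y \in C -> K x -> K y.

Definition wedge_product (D : {fset G p} -> Prop) : Prop :=
  exists K L : G p -> Prop,
    [/\ [/\ S_subgroup D K, S_subgroup D L & (forall x, K x -> L x)],
        (* K, L nontrivial and proper (K is normal since G is abelian) *)
        (exists x, K x /\ x != 0), (exists x, ~ L x) &
        forall C, D C -> (forall x, x \in C -> ~ L x) ->
          forall x k, x \in C -> K k -> x + k \in C].

Definition is_autG (s : G p -> G p) : Prop :=
  (forall x y, s (x + y) = s x + s y) /\ bijective s.

Definition finite_aut_subgroup (A : (G p -> G p) -> Prop) : Prop :=
  [/\ (forall s, A s -> is_autG s),
      A id,
      (forall s t, A s -> A t -> A (s \o t)),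
      (forall s, A s -> exists t, [/\ A t, cancel s t & cancel t s]) &
      (exists n (e : 'I_n -> G p -> G p), forall s, A s -> exists i, e i =1 s)].

Definition fixed_alg (A : (G p -> G p) -> Prop) (f : G p -> F) : Prop :=
  finsupp f /\ forall s, A s -> forall x, f (s x) = f x.

Definition automorphic (D : {fset G p} -> Prop) : Prop :=
  exists A, finite_aut_subgroup A /\
    forall f, schur_ring D f <-> fixed_alg A f.

Definition in_FZp (f : G p -> F) : Prop :=
  forall x : G p, x.1 != 0 -> f x = 0.

Definition fixed_FZp (HH : {set {perm 'Z_p}}) (f : G p -> F) : Prop :=
  in_FZp f /\ forall s, s \in HH -> forall k : 'Z_p, f (0, s k) = f (0, k).

End Defs.

Arguments schur_partition {p} F D.
Arguments schur_ring {p} F D.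
Arguments automorphic {p} F D.
Arguments in_FZp {p F} f.
Arguments fixed_FZp {p F} HH f.

(* Main.v *)
Require Import Defs.
From HB Require Import structures.
From mathcomp Require Import all_boot all_order all_algebra all_fingroup.
From mathcomp Require Import finmap.
From mathcomp Require Import zify.
From mathcomp Require boolp.
Set Implicit Arguments. Unset Strict Implicit. Unset Printing Implicit Defensive.
Import GRing.Theory Num.Theory Order.TTheory.
Local Open Scope fset_scope.
Local Open Scope ring_scope.

(** Projecting to Z, a Schur ring over Z x Z_p induces a Schur ring over Z, hence
    either every class lies in one level {n} x Z_p (discrete case) or every class
    at level n also meets level -n (symmetric case).  Call a level full when it
    lies in a single class.  If X is the part at level n of a class of a non-full
    level then 0 < |X| < p, so X is invertible mod p; hence non-full levels form
    a subgroup L, and if some level is full, Z_p <= L is a wedge decomposition.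

    If no level is full, Frobenius C^p = C^(p) mod p shows that {(pl,0), (-pl,0)}
    is a union of classes, so pZ <= H and the given class C sits at a level n prime
    to p.  For every other class C' meeting level n, with part X' there, the level-0
    part of C C'^* misses 0, so m divides |C| |X'| and therefore |X'|.  Multiplication
    by X is injective mod p, so there are at least as many classes at level n as HH-orbits
    on Z_p, namely 1 + (p-1)/m.  Counting the p points of the level forces |X| = 1.
    A power of C times some {(pl,0), (-pl,0)} then gives a class {w} or {w, w'} with w at
    level 1 and w' at level -1, and the classes are the orbits of the group
    generated by HH (fixing w) and, in the symmetric case, by the involution w <-> w'. *)

(** * Class-constant multisets *)

Section SchurClasses.
Variable V : zmodType.
Implicit Types (s t : seq V) (x y z : V).

(** A list is read as a multiset, that is, as an element of the group ring with natural coefficients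
    [count_mem x s]. Concatenation is then addition, [pairsum] the product and [mpow] the power. *)
Definition pairsum s t := [seq a + b | a <- s, b <- t].

Definition mpow s n := iter n (pairsum s) [:: 0].

Lemma count_sum (T : Type) (P : pred T) (s : seq T) :
  count P s = (\sum_(x <- s) P x)%N.
Proof. by rewrite -sum1_count big_mkcond; apply: eq_bigr => x _; case: (P x). Qed.

Lemma count_pairsum (P : pred V) s t :
  count P (pairsum s t) = (\sum_(a <- s) count (fun b => P (a + b)%R) t)%N.
Proof.
rewrite /pairsum; elim: s => [|a s IHs] /=; first by rewrite big_nil.
by rewrite count_cat IHs big_cons count_map.
Qed.

Lemma count_mem_pairsum x s t :
  count_mem x (pairsum s t) = (\sum_(a <- s) count_mem (x - a)%R t)%N.
Proof.
rewrite count_pairsum; apply: eq_bigr => a _; apply: eq_count => b /=.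
by rewrite [RHS]eq_sym subr_eq [b + a]addrC eq_sym.
Qed.

Lemma perm_pairsum s s' t t' :
  perm_eq s s' -> perm_eq t t' -> perm_eq (pairsum s t) (pairsum s' t').
Proof.
move=> ss' tt'; apply/allP => x _ /=; rewrite !count_mem_pairsum.
rewrite (perm_big _ ss'); apply/eqP; apply: eq_bigr => a _.
exact/seq.permP.
Qed.

Lemma mpowS s n : mpow s n.+1 = pairsum s (mpow s n).
Proof. by []. Qed.

(* The binomial expansion of (a + s)^n in the group ring. *)
Lemma count_mpow_cons a s n x :
  count_mem x (mpow (a :: s) n) =
  (\sum_(i < n.+1) 'C(n, i) * count_mem (x - a *+ i)%R (mpow s (n - i)))%N.
Proof.
elim: n x => [|n IHn] x; first by rewrite big_ord1 /= mulr0n subr0 mul1n.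
rewrite mpowS count_mem_pairsum big_cons.
under eq_bigr => c _ do rewrite IHn.
rewrite exchange_big /= IHn.
have E (i : 'I_n.+1) : (\sum_(c <- s) 'C(n, i) *
    count_mem (x - c - a *+ i)%R (mpow s (n - i)) =
    'C(n, i) * count_mem (x - a *+ i)%R (mpow s (n.+1 - i)))%N.
  rewrite -big_distrr subSn ?leq_ord // mpowS count_mem_pairsum.
  congr (_ * _)%N; apply: eq_bigr => c _.
  by rewrite addrAC.
under [X in (_ + X)%N]eq_bigr => i _ do rewrite E.
rewrite [RHS]big_ord_recl bin0.
under [X in _ = (_ + X)%N]eq_bigr => i _ do
  rewrite lift0 binS mulnDl addnC subSS.
rewrite big_split /= addnCA; congr (_ + _)%N.
  by apply: eq_bigr => i _; rewrite mulrS opprD addrA.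
rewrite big_ord_recl bin0; congr (_ + _)%N.
rewrite [RHS]big_ord_recr /= bin_small // mul0n addn0.
by apply: eq_bigr => i _; rewrite /bump /= add1n subSS.
Qed.

(** Frobenius in the group ring mod [q]: peeling off one entry of [s], the inner binomial
    coefficients vanish mod [q], so only the [q]-th multiples of the entries survive. *)
Lemma count_mpow_prime q s x : prime q ->
  count_mem x (mpow s q) = count (fun c => c *+ q == x)%R s %[mod q].
Proof.
move=> q_pr; have q_gt0 := prime_gt0 q_pr.
elim: s => [|a s IHs].
  by case: q q_gt0 {q_pr} => // q _; rewrite /mpow /= /pairsum.
rewrite count_mpow_cons.
case: q q_gt0 q_pr IHs => // q _ q_pr IHs.
rewrite big_ord_recl big_ord_recr /= bin0 mul1n mulr0n subr0.
rewrite /bump /= add1n binn mul1n subnn /= addn0 eq_sym subr_eq0 eq_sym.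
have dv : (q.+1 %| \sum_(i < q) 'C(q.+1, 1 + i) *
   count_mem (x - a *+ (1 + i))%R (mpow s (q.+1 - (1 + i))))%N.
  apply: dvdn_sum => i _; apply: dvdn_mulr; apply: prime_dvd_bin => //.
  exact: (ltn_ord i).
case/dvdnP: dv => d ->.
rewrite addnCA modnMDl -modnDml IHs modnDml addnC.
by rewrite eq_sym.
Qed.

(** A Schur partition presented by the map from a point to its class. The field [cls_mul] replaces
    the span condition by equality of natural structure constants, so that congruences modulo primes
    make sense. *)
Record schur_classes (cls : V -> {fset V}) : Prop := SchurClasses {
  cls_refl : forall x, x \in cls x;
  cls_eq : forall x y, y \in cls x -> cls y = cls x;
  cls_0 : cls 0 = [fset 0];
  cls_opp : forall x y, y \in cls x -> - y \in cls (- x);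
  cls_mul : forall x y z z', z' \in cls z ->
    count_mem z (pairsum (cls x) (cls y)) = count_mem z' (pairsum (cls x) (cls y))
}.

Variable cls : V -> {fset V}.
Hypothesis cls_schur : schur_classes cls.

(** These are the elements of the Schur ring with natural coefficients. *)
Definition class_const s := forall x y, y \in cls x -> count_mem x s = count_mem y s.

Lemma cls_sym x y : y \in cls x -> x \in cls y.
Proof. by move=> xy; rewrite (cls_eq cls_schur xy) cls_refl. Qed.

Lemma count_mem_fset (C : {fset V}) x : count_mem x C = (x \in C) :> nat.
Proof. by rewrite count_uniq_mem ?fset_uniq. Qed.

Lemma class_const_cls x : class_const (cls x).
Proof.
move=> y z zy; rewrite !count_mem_fset; congr nat_of_bool.
apply/idP/idP => h; first by rewrite -(cls_eq cls_schur h).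
by rewrite -(cls_eq cls_schur h) cls_sym.
Qed.

Lemma class_const_perm s t : perm_eq s t -> class_const s -> class_const t.
Proof. by move=> /seq.permP st hs x y xy; rewrite -!st; apply: hs. Qed.

Lemma class_const_mem s x y : class_const s -> y \in cls x -> x \in s -> y \in s.
Proof. by move=> hs xy; rewrite -!has_pred1 !has_count (hs _ _ xy). Qed.

(** A nonempty class-constant multiset contains the whole class of its head, and removing that class
    leaves a shorter class-constant multiset; so every such multiset is a sum of classes. *)
Lemma class_const_ind (P : seq V -> Prop) :
  (forall s t, perm_eq s t -> P s -> P t) -> P [::] ->
  (forall x s, class_const s -> P s -> P (cls x ++ s)) ->
  forall s, class_const s -> P s.
Proof.
move=> Pperm P0 Pcat s; have [n] := ubnP (size s).
elim: n s => // n IHn [|x s] // sz hs.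
have sub : {subset cls x <= x :: s}.
  by move=> y yx; apply: (class_const_mem hs yx); rewrite mem_head.
have /count_subseqP [u /perm_to_subseq [v hv] cu] :
    forall y, (count_mem y (cls x) <= count_mem y (x :: s))%N.
  move=> y; rewrite count_mem_fset.
  by case: (boolP (y \in cls x)) => // /sub; rewrite -has_pred1 has_count.
have hv' : perm_eq (x :: s) (cls x ++ v).
  by apply: (perm_trans hv); rewrite perm_cat2r perm_sym.
have iv : class_const v.
  move=> y z yz; have := hs _ _ yz.
  rewrite !(seq.permP hv') !count_cat (class_const_cls x yz).
  exact: addnI.
apply: (Pperm (cls x ++ v)); first by rewrite perm_sym.
apply: (Pcat) => //; apply: IHn => //.
have := perm_size hv'; rewrite size_cat /= => e.
have : (0 < size (cls x))%N.
  by rewrite -has_predT; apply/hasP; exists x => //; apply: cls_refl.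
by move: sz => /=; lia.
Qed.

Lemma class_const_cat s t : class_const s -> class_const t -> class_const (s ++ t).
Proof. by move=> hs ht x y xy; rewrite !count_cat (hs _ _ xy) (ht _ _ xy). Qed.

Lemma pairsum_catl s s' t : pairsum (s ++ s') t = pairsum s t ++ pairsum s' t.
Proof. by rewrite /pairsum allpairs_cat. Qed.

Lemma perm_pairsum_catr s t t' :
  perm_eq (pairsum s t ++ pairsum s t') (pairsum s (t ++ t')).
Proof.
apply/allP => x _ /=; rewrite count_cat !count_mem_pairsum -big_split /=.
by apply/eqP; apply: eq_bigr => a _; rewrite count_cat.
Qed.

(** Decomposing both factors into classes reduces the claim to [cls_mul]. *)
Lemma class_const_pairsum s t : class_const s -> class_const t -> class_const (pairsum s t).
Proof.
move=> hs ht; elim/class_const_ind: hs => [s1 s2 s12|//|x s1 hs1 IH].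
  by apply: class_const_perm; apply: perm_pairsum.
rewrite pairsum_catl; apply: class_const_cat => // {s1 hs1 IH}.
elim/class_const_ind: ht => [s1 s2 s12||y s1 hs1 IH].
- by apply: class_const_perm; apply: perm_pairsum.
- by rewrite /pairsum; elim: (enum_fset (cls x)).
apply: (class_const_perm (perm_pairsum_catr _ _ _)); apply: class_const_cat => //.
by move=> z z' zz'; exact: (cls_mul cls_schur).
Qed.

Lemma class_const_mpow s n : class_const s -> class_const (mpow s n).
Proof.
move=> hs; elim: n => [|n IHn]; last exact: class_const_pairsum.
apply: class_const_perm (class_const_cls 0).
by apply: uniq_perm => [||x]; rewrite ?fset_uniq // (cls_0 cls_schur) !inE.
Qed.

Lemma class_const_frobenius q s x y : prime q -> class_const s -> y \in cls x ->
  count (fun c => c *+ q == x) s = count (fun c => c *+ q == y) s %[mod q].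
Proof.
move=> q_pr hs xy; rewrite -!count_mpow_prime //.
by rewrite (class_const_mpow q hs xy).
Qed.

Lemma pairsum_cls_sub x y z a b : z \in cls (x + y) -> a \in cls x -> b \in cls y ->
  a + b = x + y -> exists a' b', [/\ a' \in cls x, b' \in cls y & z = a' + b'].
Proof.
move=> hz ha hb e.
have /allpairsP [[a' b'] /= [ha' hb' ->]] : z \in pairsum (cls x) (cls y).
  apply: (class_const_mem (class_const_pairsum (class_const_cls x) (class_const_cls y)) hz).
  by rewrite -e; apply/allpairsP; exists (a, b).
by exists a', b'.
Qed.

End SchurClasses.

(** * Schur rings over Z *)

Section IntegerClasses.
Variable cls : int -> {fset int}.
Hypothesis cls_schur : schur_classes cls.

(** Schur's theorem on multipliers, proved one prime factor of [j] at a time with Frobenius. *)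
Lemma class_const_dilate (s : seq int) j : (0 < j)%N -> uniq s ->
  class_const cls s -> class_const cls [seq c *+ j | c <- s].
Proof.
have injM k : (0 < k)%N -> injective (fun c : int => c *+ k).
  by move=> k_gt0 a b /eqP; rewrite eqr_pMn2r // => /eqP.
elim/ltn_ind: j s => j IHj s j_gt0 s_uniq s_const.
have [j_le1|j_gt1] := leqP j 1.
  have -> : j = 1%N by apply/eqP; rewrite eqn_leq j_le1.
  by rewrite (eq_map (g := id)) ?map_id // => c; rewrite mulr1n.
pose q := pdiv j; have q_pr : prime q by apply: pdiv_prime.
have jq : (j = (j %/ q) * q)%N by rewrite divnK // pdiv_dvd.
have j'_gt0 : (0 < j %/ q)%N by rewrite divn_gt0 ?pdiv_gt0 // pdiv_leq.
have j'_lt : (j %/ q < j)%N by rewrite ltn_Pdiv // prime_gt1.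
have := IHj _ j'_lt s j'_gt0 s_uniq s_const.
set s' := map _ s => s'_const.
have s'_uniq : uniq s' by rewrite map_inj_uniq //; apply: injM.
have -> : [seq c *+ j | c <- s] = [seq c *+ q | c <- s'].
  by rewrite -map_comp; apply: eq_map => c /=; rewrite {1}jq mulrnA.
move=> x y xy; have := class_const_frobenius cls_schur q_pr s'_const xy.

(* Multiplication by [q] is injective on the integers, so each count is 0 or 1 and the congruence
   mod [q] becomes an equality. *)
have small z : (count (fun c => c *+ q == z) s' < q)%N.
  apply: leq_ltn_trans (prime_gt1 q_pr).
  have : uniq [seq c *+ q | c <- s'].
    by rewrite map_inj_uniq //; apply: injM; apply: prime_gt0.
  by move/count_uniq_mem => /(_ z); rewrite count_map => ->; case: (_ \in _).
by rewrite !modn_small // => e; rewrite count_map [RHS]count_map.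
Qed.

Lemma seq_argmax (T : eqType) (f : T -> nat) (x : T) (s : seq T) : x \in s ->
  exists2 y, y \in s & forall z, z \in s -> (f z <= f y)%N.
Proof.
elim: s x => // x [_ _ _|y s IHs _ _].
  by exists x; rewrite ?mem_head // => z; rewrite inE => /eqP ->.
have [z zs zmax] := IHs y (mem_head _ _).
have [xz|zx] := leqP (f x) (f z).
  by exists z; [rewrite inE zs orbT | move=> u; rewrite inE => /predU1P[->|/zmax]].
exists x; rewrite ?mem_head // => u; rewrite inE => /predU1P[->//|/zmax].
by move=> h; apply: leq_trans h (ltnW zx).
Qed.

Lemma abs1_mulrn (c : int) n : `|c *+ n|%N = 1%N -> n = 1%N.
Proof.
rewrite -mulr_natr natz abszM absz_nat => e.
by apply/eqP; rewrite -dvdn1 -e dvdn_mull.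
Qed.

(* If M in [cls 1] has maximal absolute value, the union of classes |M| [cls 1]
   contains |M|, hence also 1 or -1, so |M| = 1. *)
Lemma cls1_unit x : x \in cls 1 -> x = 1 \/ x = -1.
Proof.
move=> x1; have [M M1 Mmax] := seq_argmax absz x1.
have n0 y : y \in cls 1 -> y != 0.
  move=> h; apply/eqP => y0; rewrite y0 in h.
  by have := cls_sym cls_schur h; rewrite (cls_0 cls_schur) inE.
have M_gt0 : (0 < `|M|)%N by rewrite absz_gt0 n0.
have dil := class_const_dilate M_gt0 (fset_uniq (cls 1)) (class_const_cls cls_schur 1).
have in_dil : (`|M|%N%:Z) \in [seq c *+ `|M| | c <- cls 1].
  by apply/mapP; exists 1; rewrite ?cls_refl // natz.
have hM : `|M|%N = 1%N.
  have [MM|MM] := leP 0 M.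
    have : (1 : int) \in [seq c *+ `|M| | c <- cls 1].
      apply: (class_const_mem dil _ in_dil); rewrite gez0_abs //.
      exact: cls_sym.
    by case/mapP => c _ e; apply: (abs1_mulrn (c := c)); rewrite -e.
  have : (-1 : int) \in [seq c *+ `|M| | c <- cls 1].
    apply: (class_const_mem dil _ in_dil); rewrite ltz0_abs //.
    by apply: (cls_opp cls_schur); exact: cls_sym.
  by case/mapP => c _ e; apply: (abs1_mulrn (c := c)); rewrite -e.
by have := Mmax _ x1; have := n0 _ x1; rewrite hM; lia.
Qed.

(** For [x > 0], dilating [cls 1] by [x] gives a class-constant set that contains [x] and lies in
    {x, -x}. *)
Lemma int_cls_abs x y : y \in cls x -> y = x \/ y = - x.
Proof.
wlog x_gt0 : x y / 0 < x.
  move=> W xy; case: (ltrgtP x 0) => [x0|x0|x0].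
  - have /W : - y \in cls (- x) by apply: cls_opp.
    by rewrite oppr_gt0 => /(_ x0); lia.
  - exact: W.
  - by move: xy; rewrite x0 (cls_0 cls_schur) inE => /eqP ->; left.
have -> : x = 1 *+ `|x|%N by rewrite natz; lia.
have h : (0 < `|x|)%N by lia.
have dil := class_const_dilate h (fset_uniq (cls 1)) (class_const_cls cls_schur 1).
move=> xy; have /mapP [c /cls1_unit c1 ->] : y \in [seq c *+ `|x|%N | c <- cls 1].
  by apply: (class_const_mem dil xy); apply/mapP; exists 1; rewrite ?cls_refl.
by case: c1 => ->; [left | right; rewrite mulNrn].
Qed.

Lemma class_const_seq1 x : (forall y, y \in cls x -> y = x) -> class_const cls [:: x].
Proof.
move=> h; have : perm_eq (cls x) [:: x].
  apply: uniq_perm => [||y]; rewrite ?fset_uniq // inE.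
  by apply/idP/eqP => [/h //|->]; apply: cls_refl.
by move/(class_const_perm); apply; apply: class_const_cls.
Qed.

(** The class of 1 decides. If it is {1}, its dilates make every positive integer a class of its
    own. If it is {1, -1}, a singleton class {x} with [x > 0] would force {x + 1} to be one as well,
    and then the difference 1 would be alone in its class. *)
Lemma int_cls_dichotomy :
  (forall x y, y \in cls x -> y = x) \/ (forall x, - x \in cls x).
Proof.
have cst1 := class_const_cls cls_schur.
case: (boolP (-1 \in cls 1)) => [N1|N1]; last first.
  left; have h1 : forall y, y \in cls 1 -> y = 1.
    by move=> y /[dup] h /cls1_unit [] // e; rewrite e (negPf N1) in h.
  move=> x y xy; have := int_cls_abs xy; case=> // e.
  case: (eqVneq x 0) => [x0|x0]; first by rewrite e x0 oppr0.
  have pos z : 0 < z -> - z \notin cls z.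
    move=> z_gt0; apply/negP => zz.
    have h : (0 < `|z|)%N by lia.
    have ez : z = 1 *+ `|z|%N by rewrite natz; lia.
    have dil := class_const_dilate h (fset_uniq (cls 1)) (cst1 1).
    have /mapP [c /h1 -> e'] : - z \in [seq c *+ `|z|%N | c <- cls 1].
      apply: (class_const_mem dil zz); rewrite [X in X \in _]ez; apply/mapP; exists 1 => //.
      exact: cls_refl.
    by move: e'; rewrite -ez; lia.
  case: (ltrgtP x 0) => [xl|xg|xe].
  - by have := pos (- x); rewrite opprK oppr_gt0 => /(_ xl)/negP []; rewrite -e cls_sym.
  - by have := pos _ xg; rewrite -e xy.
  - by rewrite xe eqxx in x0.
right=> x; wlog x_gt0 : x / 0 < x.
  move=> W; case: (ltrgtP x 0) => [x0|x0|x0]; first 2 last.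
  - by rewrite x0 oppr0 cls_refl.
  - by have := W (- x); rewrite opprK oppr_gt0 => /(_ x0); apply: cls_sym.
  - exact: W.
apply: contraT => Nx.
have c_x : class_const cls [:: x].
  by apply: class_const_seq1 => y /[dup] h /int_cls_abs [] // e; rewrite -e h in Nx.
have h := class_const_pairsum cls_schur c_x (cst1 1).
have c_x1 : class_const cls [:: x + 1].
  apply: class_const_seq1 => y /[dup] xy /int_cls_abs [] // e.
  have /allpairsP [[a b] /= []] : y \in pairsum [:: x] (cls 1).
    apply: (class_const_mem h xy); apply/allpairsP; exists (x, 1).
    by rewrite mem_head cls_refl.
  by rewrite inE => /eqP -> /cls1_unit [] ->; lia.
have c_Nx : class_const cls [:: - x].
  apply: class_const_seq1 => y xy.
  have /(class_const_mem c_x) : - y \in cls x by rewrite -(opprK x); apply: cls_opp.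
  by rewrite mem_head inE => /(_ isT) /eqP <-; rewrite opprK.
have := class_const_mem (class_const_pairsum cls_schur c_x1 c_Nx) N1.
by rewrite /= !inE; lia.
Qed.

End IntegerClasses.

(** * Levels and the quotient by Z_p *)

Section Levels.
Variables (p : nat) (cls : G p -> {fset G p}).
Hypothesis cls_schur : schur_classes cls.
Hypothesis level0 : forall x y : G p, y \in cls x -> x.1 = 0 -> y.1 = 0.

Definition level (l : int) : pred (G p) := fun x => x.1 == l.

Definition fiber_Zp : seq (G p) := [seq (0, i) | i <- enum 'Z_p].

Lemma count_mem_fiber_Zp x : count_mem x fiber_Zp = (x.1 == 0) :> nat.
Proof.
rewrite count_uniq_mem; last first.
  by rewrite map_inj_uniq ?enum_uniq // => i j [].
congr nat_of_bool; apply/mapP/eqP => [[i _ ->]//|x0].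
by exists x.2; rewrite ?mem_enum // -x0; case: (x).
Qed.

Lemma class_const_fiber_Zp : class_const cls fiber_Zp.
Proof.
move=> x y xy; rewrite !count_mem_fiber_Zp; congr nat_of_bool.
apply/eqP/eqP; first exact: level0.
exact/level0/cls_sym.
Qed.

Lemma count_pairsum_fiber_Zp x s :
  count_mem x (pairsum s fiber_Zp) = count (level x.1) s.
Proof.
rewrite count_mem_pairsum count_sum; apply: eq_bigr => a _.
by rewrite count_mem_fiber_Zp /level /= subr_eq0 eq_sym.
Qed.

(** Multiplying [s] by the sum of Z_p turns its number of points on a level into a coefficient. In
    particular a class has equally many points on each level that it meets. *)
Lemma count_level_const s x y : class_const cls s -> y \in cls x ->
  count (level x.1) s = count (level y.1) s.
Proof.
move=> s_const xy; rewrite -!count_pairsum_fiber_Zp.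
exact: (class_const_pairsum cls_schur s_const class_const_fiber_Zp).
Qed.

Definition quotient_cls (n : int) : {fset int} := [fset x.1 | x in cls (n, 0)].

(** The image in Z does not depend on the representative at level [n]: [cls (n, i)] meets level [n],
    hence by [count_level_const] every level met by the class of another point of level [n]. *)
Lemma quotient_clsP n i a :
  reflect (exists j, (a, j) \in cls (n, i)) (a \in quotient_cls n).
Proof.
apply: (iffP (imfsetP _ _ _ _)) => [[[b k] /= y_n ->]|[j aj]].
  have cc := class_const_cls cls_schur (n, i).
  have : has (level b) (cls (n, i)).
    rewrite has_count -(count_level_const cc y_n) -has_count.
    by apply/hasP; exists (n, i); rewrite /level ?cls_refl /=.
  by case/hasP => -[c j] cj /eqP /= <-; exists j.
have cc := class_const_cls cls_schur (n, 0).
have : has (level a) (cls (n, 0)).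
  rewrite has_count -(count_level_const cc aj) -has_count.
  by apply/hasP; exists (n, 0); rewrite /level ?cls_refl /=.
by case/hasP => y yn /eqP ya; exists y.
Qed.

Lemma class_const_lift (s : seq int) : class_const quotient_cls s ->
  class_const cls [seq (n, i) | n <- s, i <- enum 'Z_p].
Proof.
have cnt (x : G p) : count_mem x [seq (n, i) | n <- s, i <- enum 'Z_p] = count_mem x.1 s.
  elim: s => //= n s IHs; rewrite count_cat IHs; congr (_ + _)%N.
  rewrite count_map; case: eqP => [nx|nx].
    transitivity (count_mem x.2 (enum 'Z_p)); last first.
      by rewrite count_uniq_mem ?enum_uniq // mem_enum.
    by apply: eq_count => i; case: x {IHs} nx => a b /= ->; rewrite xpair_eqE eqxx.
  apply/eqP; rewrite -leqn0 leqNgt -has_count; apply/hasP => -[i _ /= /eqP e].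
  by apply: nx; rewrite -e.
move=> s_const [n i] [a j] xy; rewrite !cnt; apply: s_const.
by apply/(quotient_clsP n i); exists j.
Qed.

(** For the structure constants, both factors are pulled back to G. Each pair of integers with a
    given sum lifts to a pair in G in |Z_p|^2 ways, and this common factor cancels. *)
Lemma schur_classes_quotient : schur_classes quotient_cls.
Proof.
split.
- by move=> n; apply/(quotient_clsP n 0); exists 0; apply: cls_refl.
- move=> n a /(quotient_clsP n 0) [j aj]; apply/fsetP => b.
  apply/(quotient_clsP a j)/(quotient_clsP n 0) => -[k bk]; exists k.
    by rewrite -(cls_eq cls_schur aj).
  by rewrite (cls_eq cls_schur aj).
- apply/fsetP => a; rewrite inE; apply/(quotient_clsP 0 0)/eqP => [[j]|->].
    by rewrite (cls_0 cls_schur) inE => /eqP [].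
  by exists 0; apply: cls_refl.
- move=> n a /(quotient_clsP n 0) [j /(cls_opp cls_schur) aj].
  by apply/(quotient_clsP (- n) (- 0)); exists (- j).
move=> a b z z' /(quotient_clsP z 0) [j zz'].
have card_Zp_gt0 : (0 < size (enum 'Z_p))%N by rewrite -cardE; apply/card_gt0P; exists 0.
have lift_const n : class_const cls [seq (k, i) | k <- quotient_cls n, i <- enum 'Z_p].
  apply: class_const_lift => x y /(quotient_clsP x 0) [k yk].
  rewrite !count_mem_fset; congr nat_of_bool.
  apply/(quotient_clsP n 0)/(quotient_clsP n 0) => -[l hl].
    have : y \in quotient_cls x by apply/(quotient_clsP x 0); exists k.
    case/(quotient_clsP x l) => l' hl'; exists l'.
    by rewrite -(cls_eq cls_schur hl).
  have : x \in quotient_cls y.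
    by apply/(quotient_clsP y k); exists 0; apply: cls_sym.
  case/(quotient_clsP y l) => l' hl'; exists l'.
  by rewrite -(cls_eq cls_schur hl).
have := count_level_const
  (class_const_pairsum cls_schur (lift_const a) (lift_const b)) zz'.
have cnt (s t : seq int) n : count (level n)
    (pairsum [seq (k, i) | k <- s, i <- enum 'Z_p] [seq (k, i) | k <- t, i <- enum 'Z_p])
    = (size (enum 'Z_p) * size (enum 'Z_p) * count_mem n (pairsum s t))%N.
  rewrite !count_pairsum big_allpairs /=.
  rewrite big_distrr; apply: eq_bigr => k _ /=.
  have E i : count (fun b : G p => level n ((k, i) + b)) [seq (l, j) | l <- t, j <- enum 'Z_p]
      = (size (enum 'Z_p) * count (fun l => k + l == n)%R t)%N.
    rewrite !count_sum big_allpairs big_distrr; apply: eq_bigr => l _ /=.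
    rewrite (eq_bigr (fun=> ((k + l == n)%R : nat))) //.
    by rewrite big_const_seq count_predT iter_addn_0 mulnC.
  under eq_bigr => i _ do rewrite E.
  by rewrite big_const_seq count_predT iter_addn_0 mulnC mulnA.
rewrite !cnt => /eqP; rewrite eqn_pmul2l ?muln_gt0 ?card_Zp_gt0 //.
by move/eqP.
Qed.

Lemma level_abs (x y : G p) : y \in cls x -> y.1 = x.1 \/ y.1 = - x.1.
Proof.
case: x y => [n i] [a j] xy.
apply: (int_cls_abs schur_classes_quotient).
by apply/(quotient_clsP n i); exists j.
Qed.

Lemma level_dichotomy : (forall x y, y \in cls x -> y.1 = x.1) \/
  (forall x, exists j, (- x.1, j) \in cls x).
Proof.
case: (int_cls_dichotomy schur_classes_quotient) => h; [left | right].
  move=> [n i] [a j] xy; apply: h.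
  by apply/(quotient_clsP n i); exists j.
by move=> [n i]; apply/(quotient_clsP n i)/h.
Qed.

End Levels.

(** * Convolution on Z_p with coefficients mod p *)

Section Circulant.
Variable p : nat.
Hypothesis p_pr : prime p.

(** On row vectors this matrix is multiplication by the sum of [X] in the group algebra of Z_p over
    the field with p elements; ['Z_p] serves both as index group and as scalars. *)
Definition circulant (X : {set 'Z_p}) : 'M['Z_p]_((Zp_trunc p).+2) :=
  \matrix_(i, j) (j - i \in X)%:R.

Definition translation (x : 'Z_p) : {perm 'Z_p} := perm (addIr x).

Lemma translation_expn x n : (translation x ^+ n)%g = translation (x *+ n).
Proof.
apply/permP => i; rewrite permE.
elim: n i => [|n IHn] i; first by rewrite expg0 perm1 mulr0n addr0.
by rewrite expgSr permM IHn permE mulrSr addrA.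
Qed.

Lemma translation0 : translation 0 = 1%g.
Proof. by apply/permP => i; rewrite permE perm1 addr0. Qed.

Lemma mulrn_Zp_p (x : 'Z_p) : x *+ p = 0.
Proof. by rewrite -mulr_natr pchar_Zp ?prime_gt1 // mulr0. Qed.

Lemma circulantE X : circulant X = \sum_(x in X) perm_mx (translation x).
Proof.
apply/matrixP => i j; rewrite mxE summxE.
under eq_bigr => x _ do rewrite !mxE permE.
case: (boolP (j - i \in X)) => [jX|jX].
  rewrite (bigD1 (j - i)) //= [_ + (j - i)]addrC subrK eqxx big1 ?addr0 // => x /andP [_ ne].
  by case: eqP => // e; move: ne; rewrite -e [i + x - i]addrC addKr eqxx.
rewrite big1 // => x xX; case: eqP => // e.
by move: jX; rewrite -e [i + x - i]addrC addKr xX.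
Qed.

(* By Frobenius, the [p]-th power of the circulant matrix is the scalar [#|X|]. *)
Lemma circulant_unit (X : {set 'Z_p}) : ~~ (p %| #|X|)%N -> circulant X \in unitmx.
Proof.
move=> pX.
have pch : p \in [pchar 'M['Z_p]_((Zp_trunc p).+2)].
  rewrite inE p_pr /= -(rmorph_nat (@scalar_mx _ _)).
  by rewrite pchar_Zp ?prime_gt1 // raddf0.
have expE x n : perm_mx (translation x) ^+ n = perm_mx (translation x ^+ n)%g
    :> 'M['Z_p]_((Zp_trunc p).+2).
  elim: n => [|n IHn]; first by rewrite expr0 expg0 perm_mx1.
  by rewrite exprS IHn -[_ * _]perm_mxM -expgS.
have comm x y : GRing.comm (perm_mx (translation x) : 'M['Z_p]_((Zp_trunc p).+2))
    (perm_mx (translation y)).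
  rewrite /GRing.comm -![_ * _]perm_mxM; congr perm_mx; apply/permP => i.
  by rewrite !permM !permE addrAC.
have frob : circulant X ^+ p = (#|X|%:R)%:M.
  rewrite circulantE -(pFrobenius_autE pch) -sum1_card natr_sum raddf_sum /=.
  (* Additivity of Frobenius needs commuting summands, so the induction also carries that partial
     sums commute with all translation matrices. *)
  have [] : (forall y, GRing.comm
        (\sum_(x in X) perm_mx (translation x) : 'M['Z_p]_((Zp_trunc p).+2))
        (perm_mx (translation y))) /\
      pFrobenius_aut pch (\sum_(x in X) perm_mx (translation x)) =
      \sum_(x in X) (1%:R)%:M; last by move=> _ ->.
  elim/big_rec2: _ => [|x A B _ [commB frobB]].
    by split=> [y|]; [apply/commr_sym/commr0 | rewrite pFrobenius_aut0].
  split=> [y|]; first by apply/commr_sym/commrD; apply: commr_sym.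
  rewrite pFrobenius_autD_comm; last exact/commr_sym/commB.
  by rewrite frobB pFrobenius_autE expE translation_expn mulrn_Zp_p translation0 perm_mx1.
change (circulant X \is a GRing.unit).
rewrite -(unitrX_pos _ (prime_gt0 p_pr)) frob.
change ((#|X|%:R%:M : 'M['Z_p]_((Zp_trunc p).+2)) \in unitmx).
by rewrite unitmxE det_scalar unitrX // unitZpE ?prime_gt1 // prime_coprime.
Qed.

(* An injective linear map from [b1]-constant to [b2]-constant vectors: count both
   (finite) spaces. *)
Lemma leq_card_labels (L : finType) (b1 b2 : 'Z_p -> L) (M : 'M['Z_p]_((Zp_trunc p).+2)) :
  M \in unitmx ->
  (forall v : 'rV['Z_p]_((Zp_trunc p).+2), (forall i j, b1 i = b1 j -> v 0 i = v 0 j) ->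
     forall i j, b2 i = b2 j -> (v *m M) 0 i = (v *m M) 0 j) ->
  (#|[set b1 i | i : 'Z_p]| <= #|[set b2 i | i : 'Z_p]|)%N.
Proof.
move=> M_unit const12.
(* Constant vectors are encoded by functions on labels that vanish off the attained labels, which
   makes the encoding unique and easy to count. [rep] picks a point carrying a given label. *)
pose ev (g : {ffun L -> 'Z_p}) : 'rV['Z_p]_((Zp_trunc p).+2) := \row_j g (b1 j).
pose rep (a : L) := odflt 0 [pick i | b2 i == a].
pose Phi (g : {ffun L -> 'Z_p}) := [ffun a : L =>
  if a \in [set b2 i | i : 'Z_p] then (ev g *m M) 0 (rep a) else 0].
pose dom (b : 'Z_p -> L) := pffun_on (0 : 'Z_p) (mem [set b i | i : 'Z_p]) predT.
have b2_rep j : b2 (rep (b2 j)) = b2 j.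
  by rewrite /rep; case: pickP => [i /eqP //|/(_ j)]; rewrite eqxx.
have Phi_inj : {in dom b1 &, injective Phi}.
  move=> g g' /pffun_onP [/subsetP sg _] /pffun_onP [/subsetP sg' _] e.
  have ev_eq : ev g = ev g'.
    apply: (can_inj (mulmxK M_unit)); apply/rowP => j.
    have cst (f : {ffun L -> 'Z_p}) : (ev f *m M) 0 j = Phi f (b2 j).
      rewrite ffunE imset_f //; apply: const12; last by rewrite b2_rep.
      by move=> i k eik; rewrite !mxE eik.
    by rewrite !cst e.
  apply/ffunP => a; case: (boolP (a \in [set b1 i | i : 'Z_p])) => [/imsetP [i _ ->]|na].
    by have /rowP /(_ i) := ev_eq; rewrite !mxE.
  have out (f : {ffun L -> 'Z_p}) : {subset 0.-support f <= [set b1 i | i : 'Z_p]} -> f a = 0.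
    by move=> sf; apply/eqP; apply: contraNT na => fa; apply: sf.
  by rewrite (out _ sg) (out _ sg').
have sub : [set Phi g | g in dom b1] \subset dom b2.
  apply/subsetP => _ /imsetP [g _ ->]; apply/pffun_onP; split=> //.
  by apply/subsetP => a; rewrite !inE ffunE; case: ifP => //; rewrite eqxx.
have := subset_leq_card sub; rewrite (card_in_imset Phi_inj) !card_pffun_on.
by rewrite leq_exp2l // card_ord.
Qed.

End Circulant.

(** * Full levels and counting mod m *)

Section Counting.
Variables (p : nat) (cls : G p -> {fset G p}) (HH : {group {perm 'Z_p}}).
Hypothesis p_pr : prime p.
Hypothesis cls_schur : schur_classes cls.
Hypothesis cls_level0 : forall i (y : G p),
  y \in cls (0, i) <-> y.1 = 0 /\ exists2 h, h \in HH & h i = y.2.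

Lemma level0_stable (x y : G p) : y \in cls x -> x.1 = 0 -> y.1 = 0.
Proof. by case: x => n i /= + n0; rewrite n0 => /cls_level0 []. Qed.
Let level0 := level0_stable.

Lemma card_Zp_prime : #|'Z_p| = p.
Proof. by rewrite card_ord Zp_cast ?prime_gt1. Qed.

Definition fiber (x : G p) : {set 'Z_p} := [set i | (x.1, i) \in cls x].

Lemma sum_level (F : 'Z_p -> nat) l (s : seq (G p)) :
  (\sum_(a <- s) (if a.1 == l then F a.2 else 0) =
   \sum_(i : 'Z_p) count_mem (l, i) s * F i)%N.
Proof.
under [RHS]eq_bigr => i _ do rewrite count_sum big_distrl /=.
rewrite exchange_big; apply: eq_bigr => -[n j] _ /=.
rewrite (bigD1 j) //= xpair_eqE eqxx andbT big1 => [|i /negPf ij].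
  by case: eqP; rewrite ?mul1n ?mul0n addn0.
by rewrite xpair_eqE [j == i]eq_sym ij andbF.
Qed.

Lemma count_level_sum l (s : seq (G p)) :
  count (level l) s = (\sum_(i : 'Z_p) count_mem (l, i) s)%N.
Proof.
transitivity (\sum_(i : 'Z_p) count_mem (l, i) s * 1)%N.
  by rewrite -sum_level count_sum; apply: eq_bigr => a _; rewrite /level; case: eqP.
by apply: eq_bigr => i _; rewrite muln1.
Qed.

Lemma card_fiber x : #|fiber x| = count (level x.1) (cls x).
Proof.
rewrite count_level_sum -sum1_card big_mkcond; apply: eq_bigr => i _.
by rewrite count_mem_fset inE; case: (_ \in _).
Qed.

Lemma count_level_cls x y : y \in cls x -> count (level y.1) (cls x) = #|fiber x|.
Proof.
by move=> xy; rewrite card_fiber (count_level_const cls_schur level0 _ xy) //;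
  apply: class_const_cls.
Qed.

Lemma mem_fiber (x : G p) : x.2 \in fiber x.
Proof. by rewrite inE -surjective_pairing cls_refl. Qed.

Lemma fiber_eq n i j : j \in fiber (n, i) -> fiber (n, j) = fiber (n, i).
Proof. by rewrite inE /= => h; apply/setP => k; rewrite !inE /= (cls_eq cls_schur h). Qed.

Definition full n : bool := [forall j, (n, j) \in cls (n, 0)].

Lemma fullP n i j : full n -> (n, j) \in cls (n, i).
Proof.
move/forallP => h; have /(cls_eq cls_schur) -> := h i.
exact: h.
Qed.

Lemma card_fiber_lt n i : ~~ full n -> (#|fiber (n, i)| < p)%N.
Proof.
apply: contraR; rewrite -leqNgt -{1}card_Zp_prime => le.
have /eqP fib : fiber (n, i) == [set: 'Z_p] by rewrite eqEcard subsetT cardsT.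
have h j : (n, j) \in cls (n, i).
  by have := in_setT j; rewrite -fib inE.
by apply/forallP => j; rewrite (cls_eq cls_schur (h 0)).
Qed.

Lemma card_fiber_gt0 x : (0 < #|fiber x|)%N.
Proof. by apply/card_gt0P; exists x.2; apply: mem_fiber. Qed.

Lemma card_fiber_ndvd n i : ~~ full n -> ~~ (p %| #|fiber (n, i)|)%N.
Proof. by move=> nf; rewrite gtnNdvd ?card_fiber_gt0 ?card_fiber_lt. Qed.

Lemma full0 : ~~ full 0.
Proof.
apply/forallP => /(_ 1); rewrite (cls_0 cls_schur) inE xpair_eqE /=.
by rewrite oner_eq0.
Qed.

Lemma fullN n : full n -> full (- n).
Proof.
move=> f; apply/forallP => j; rewrite -[j]opprK -oppr0.
by apply: (cls_opp cls_schur (x := (n, 0)) (y := (n, - j))); apply: fullP.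
Qed.

Lemma full_cls (x y : G p) : y \in cls x -> full x.1 -> full y.1.
Proof. by move/(level_abs cls_schur level0) => [] -> // /fullN. Qed.

(** If level [n + m] were full, the product of [cls (n, 0)] and [cls (m, 0)] would have a constant
    coefficient on its p points. The sum over that level would be divisible by p, yet it is a
    product of two fibre sizes strictly between 0 and p. *)
Lemma fullD n m : ~~ full n -> ~~ full m -> ~~ full (n + m).
Proof.
case: (eqVneq n 0) => [->|n0]; first by rewrite add0r.
case: (eqVneq m 0) => [->|m0]; first by rewrite addr0.
move=> nfn nfm; apply/negP => f.
have nm0 : n + m != 0 by apply: contraTneq f => ->; apply: full0.
have labs := level_abs cls_schur level0.
(* The classes live on levels n, -n and m, -m. As n, m and n + m are nonzero, only the pair of
   levels (n, m) adds up to n + m. *)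
have total : count (level (n + m)) (pairsum (cls (n, 0)) (cls (m, 0))) =
    (#|fiber (n, 0%R)| * #|fiber (m, 0%R)|)%N.
  rewrite count_pairsum card_fiber count_sum big_distrl /=.
  rewrite big_seq_cond [RHS]big_seq_cond; apply: eq_bigr => a /andP [/labs /= an _].
  rewrite /level /=; case: eqP => [e|ne].
    rewrite mul1n card_fiber; apply: eq_count => b.
    by rewrite /level /= e (inj_eq (addrI n)).
  apply/eqP; rewrite mul0n -leqn0 leqNgt -has_count; apply/hasP => -[b /labs /= bm /eqP].
  by case: an bm => // -> [] ->; move/eqP: n0; move/eqP: m0; move/eqP: nm0; lia.
have : (p %| #|fiber (n, 0%R)| * #|fiber (m, 0%R)|)%N.
  have cst := class_const_pairsum cls_schur (class_const_cls cls_schur ((n, 0) : G p))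
                (class_const_cls cls_schur ((m, 0) : G p)).
  rewrite -total count_level_sum.
  rewrite (eq_bigr (fun=> count_mem (n + m, 0) (pairsum (cls (n, 0)) (cls (m, 0))))).
    rewrite sum_nat_const; apply: dvdn_mulr.
    have dv : (p %| #|'Z_p|)%N by rewrite card_Zp_prime.
    exact: dv.
  by move=> i _; apply: cst; apply: fullP.
by rewrite Euclid_dvdM // !(negPf (card_fiber_ndvd _ _)).
Qed.

(** Multiplication by p kills the Z_p-coordinate, so mod p the p-th power of [cls (n, 0)] has the
    fibre size as its coefficient at [(n *+ p, 0)]. This is nonzero mod p, hence so is the
    coefficient at [y], and [y] is the p-th multiple of a point at level n or -n. *)
Lemma cls_mulp n y : ~~ full n -> y \in cls (n *+ p, 0) ->
  y = (n *+ p, 0) \/ y = (- n *+ p, 0).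
Proof.
move=> nf xy.
have mulp (c : G p) : c *+ p = (c.1 *+ p, 0).
  by rewrite [LHS]surjective_pairing raddfMn raddfMn /= mulrn_Zp_p.
have := class_const_frobenius cls_schur p_pr (class_const_cls cls_schur ((n, 0) : G p)) xy.
have -> : count (fun c : G p => c *+ p == (n *+ p, 0)) (cls (n, 0)) = #|fiber (n, 0)|.
  rewrite card_fiber; apply: eq_count => c; rewrite mulp xpair_eqE eqxx andbT.
  by rewrite eqr_pMn2r ?prime_gt0.
move=> e; have : has (fun c : G p => c *+ p == y) (cls (n, 0)).
  rewrite has_count lt0n; apply/eqP => z; move: e; rewrite z mod0n.
  by apply/eqP; apply: card_fiber_ndvd.
case/hasP => c /(level_abs cls_schur level0) /= cn /eqP <-.
by rewrite mulp; case: cn => ->; [left | right].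
Qed.

Hypothesis HH_aut : (HH \subset Aut [set: 'Z_p])%g.

Lemma HH_mul h i : h \in HH -> h i = i * h 1.
Proof.
move=> hH; have /Aut_morphic/morphicP hM := subsetP HH_aut _ hH.
have hD x y : h (x + y) = h x + h y by apply: hM; rewrite inE.
have h0 : h 0 = 0 by apply: (addrI (h 0)); rewrite -hD !addr0.
rewrite -{1}[i]natr_Zp -{2}[i]natr_Zp mulr_natl.
by elim: (nat_of_ord i) => [|n IHn]; rewrite ?mulr0n // !mulrS hD IHn.
Qed.

Lemma unit_Zp (i : 'Z_p) : i != 0 -> i \is a GRing.unit.
Proof.
move=> i0; rewrite -[i]natr_Zp unitZpE ?prime_gt1 // prime_coprime // gtnNdvd ?lt0n //.
by have := ltn_ord i; rewrite [X in (_ < X)%N]Zp_cast ?prime_gt1.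
Qed.

(** Elements of [HH] are multiplications by scalars, so one that fixes a unit is the identity. *)
Lemma card_orbit_HH (i : 'Z_p) : i != 0 -> #|orbit 'P%act HH i| = #|HH|.
Proof.
move=> i0; rewrite card_orbit.
suff -> : 'C_HH[i | 'P]%g = 1%g by rewrite indexg1.
apply/trivgP/subsetP => h; rewrite inE => /andP [hH /astab1P].
rewrite inE /= apermE HH_mul // -{2}[i]mulr1 => /(mulrI (unit_Zp i0)) h1.
by apply/eqP/permP => j; rewrite perm1 HH_mul // h1 mulr1.
Qed.

Lemma orbit_HH_cls i j : j \in orbit 'P%act HH i -> (0, j) \in cls (0, i).
Proof. by case/orbitP => h hH <-; apply/cls_level0; split=> //; exists h. Qed.

(** Level 0 without 0 splits into [HH]-orbits of size exactly |HH|, on each of which the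
    multiplicity is constant. *)
Lemma count_level0_mod (s : seq (G p)) : class_const cls s ->
  count (level 0) s = count_mem 0 s %[mod #|HH|].
Proof.
move=> s_const; rewrite count_level_sum (bigD1 0) //=.
pose S := [set~ (0 : 'Z_p)].
have acts : [acts HH, on S | 'P].
  apply/actsP => h hH i; rewrite !inE /= apermE.
  have h0 : h 0 = 0 by rewrite HH_mul // mul0r.
  by rewrite -{1}h0 (inj_eq perm_inj).
rewrite (eq_bigl (mem S)); last by move=> i; rewrite !inE.
rewrite (set_partition_big _ (orbit_partition acts)) /=.
suff /dvdnP [d ->] : (#|HH| %| \sum_(A in [set orbit 'P%act HH i | i in S])
   \sum_(i in A) count_mem ((0, i) : G p)%R s)%N by rewrite addnC modnMDl.
apply: dvdn_sum => A /imsetP [i]; rewrite !inE => i0 ->.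
rewrite (eq_bigr (fun=> count_mem (0, i) s)); last first.
  by move=> j ij; apply/esym/s_const/orbit_HH_cls.
by rewrite sum_nat_const card_orbit_HH // dvdn_mulr.
Qed.

(** The orbit of 0 is a single point, which accounts for the 1; every other orbit has at most |HH|
    points. *)
Lemma card_orbits : (p <= 1 + (#|[set orbit 'P%act HH i | i : 'Z_p]| - 1) * #|HH|)%N.
Proof.
have acts : [acts HH, on [set: 'Z_p] | 'P].
  by apply/actsP => h hH i; rewrite !inE.
have -> : [set orbit 'P%act HH i | i : 'Z_p] = [set orbit 'P%act HH i | i in [set: 'Z_p]].
  by apply/setP => A; apply/imsetP/imsetP => -[i _ ->]; exists i.
rewrite -{1}card_Zp_prime -cardsT (card_partition (orbit_partition acts)).
rewrite (bigD1 (orbit 'P%act HH 0)) /=; last by apply: imset_f; rewrite inE.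
apply: leq_add.
  rewrite -(cards1 (0 : 'Z_p)); apply/subset_leq_card/subsetP => i.
  by move/orbit_HH_cls; rewrite (cls_0 cls_schur) !inE => /eqP [->].
rewrite (cardsD1 (orbit 'P%act HH 0)) imset_f ?inE // addKn.
rewrite -sum_nat_const [X in (_ <= X)%N](eq_bigl (fun A : {set 'Z_p} =>
  (A \in [set orbit 'P%act HH i | i in setT]) && (A != orbit 'P%act HH 0))); last first.
  by move=> A; rewrite in_setD1 andbC.
apply: leq_sum => A /andP [/imsetP [i _ ->] _].
by rewrite dvdn_leq ?cardG_gt0 ?dvdn_orbit.
Qed.

(** Multiplying by the fibre of [(n, 0)] is invertible mod p and takes [HH]-invariant vectors to
    vectors constant on the fibres at level [n]. *)
Lemma card_orbits_fibers n : ~~ full n ->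
  (#|[set orbit 'P%act HH j | j : 'Z_p]| <= #|[set fiber (n, j) | j : 'Z_p]|)%N.
Proof.
move=> nf.
have M_unit := circulant_unit p_pr (card_fiber_ndvd 0 nf).
apply: (leq_card_labels M_unit).
move=> v v_orb j k jk.
pose u (l : 'Z_p) : nat := v 0 l.
(* The entries of [v] are lifted to natural numbers and used as multiplicities at level 0. Then [v]
   times the circulant matrix consists of the coefficients of [cls (n, 0)] times [s] at level [n],
   reduced mod p. *)
pose s : seq (G p) := flatten [seq nseq (u l) (0, l) | l <- enum 'Z_p].
have cnt_s x : count_mem x s = (if x.1 == 0 then u x.2 else 0%N).
  rewrite count_flatten -map_comp sumnE big_map big_enum /=.
  rewrite (bigD1 x.2) //= count_nseq big1 ?addn0 => [|l lx].
    by case: x => a b /=; rewrite xpair_eqE eqxx andbT eq_sym; case: eqP; rewrite ?mul1n.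
  by case: x lx => a b /= lb; rewrite count_nseq /= xpair_eqE (negPf lb) andbF.
have s_const : class_const cls s.
  move=> [a l] y xy; rewrite !cnt_s /=; case: (eqVneq a 0) => [a0|a0].
    move: xy; rewrite a0 => /cls_level0 [-> [h hH e]]; rewrite eqxx.
    rewrite /u (v_orb l y.2) // -e; apply/orbit_eqP/orbitP; exists h^-1%g; rewrite ?groupV //.
    by rewrite /= apermE permK.
  by case: eqP => // y0; case/eqP: a0; apply: (level0 (cls_sym cls_schur xy)).
have main l : (v *m circulant (fiber (n, 0%R))) 0 l =
    (count_mem ((n, l) : G p) (pairsum (cls (n, 0)) s))%:R.
  rewrite mxE count_mem_pairsum.
  rewrite (eq_bigr (fun a : G p => if a.1 == n then u (l - a.2)%R else 0%N)).
    rewrite (sum_level (fun j => u (l - j)%R)) natr_sum (reindex_inj (subrI l)) /=.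
    apply: eq_bigr => j' _; rewrite !mxE count_mem_fset natrM natr_Zp mulrC.
    by rewrite opprB addrC subrK inE.
  by move=> a _; rewrite cnt_s /= subr_eq0 eq_sym.
rewrite !main; congr _%:R.
apply: (class_const_pairsum cls_schur (class_const_cls cls_schur _) s_const).
have : k \in fiber (n, k) by apply: (mem_fiber (n, k)).
by rewrite -jk inE.
Qed.

Lemma sum_card_fibers n :
  (\sum_(A in [set fiber (n, j) | j : 'Z_p]) #|A| = p)%N.
Proof.
rewrite -[RHS]card_Zp_prime -sum1_card.
rewrite (partition_big (fun j => fiber (n, j)) (mem [set fiber (n, j) | j : 'Z_p])) /=; last first.
  by move=> j _; apply: imset_f.
apply: eq_bigr => _ /imsetP [j _ ->]; rewrite -sum1_card; apply: eq_bigl => k /=.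
apply/idP/eqP => [/fiber_eq //|<-].
by apply: (mem_fiber (n, k)).
Qed.

(** With y = (x.1, j), consider the product of [cls x] and [cls (- y)]. Its coefficient at 0 counts
    common points of two distinct classes, so it is 0, while every point of [cls x] has as many
    partners landing on level 0 as the fibre of y has points. Now [count_level0_mod] applies. *)
Lemma dvdn_card_fiber x j : (x.1, j) \notin cls x ->
  (#|HH| %| #|` cls x| * #|fiber (x.1, j)|)%N.
Proof.
move=> xj; pose y : G p := (x.1, j).
have s_const := class_const_pairsum cls_schur
  (class_const_cls cls_schur x) (class_const_cls cls_schur (- y)).
have perm_opp : perm_eq (cls (- y)) [seq - b | b <- cls y].
  apply: uniq_perm => [||b]; rewrite ?(map_inj_uniq oppr_inj) ?fset_uniq //.
  apply/idP/mapP => [/(cls_opp cls_schur)|[c hc ->]]; last exact: (cls_opp cls_schur).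
  by rewrite opprK => hb; exists (- b); rewrite ?opprK.
have := count_level0_mod s_const.
have -> : count_mem 0 (pairsum (cls x) (cls (- y))) = 0%N.
  apply/eqP; rewrite -leqn0 leqNgt -has_count has_pred1; apply/negP.
  case/allpairsP => -[a b] /= [ax by_ /eqP].
  rewrite eq_sym addr_eq0 => /eqP ab; case/negP: xj.
  have ay : a \in cls y by rewrite ab -[y]opprK; apply: (cls_opp cls_schur).
  by rewrite -(cls_eq cls_schur ax) (cls_eq cls_schur ay) cls_refl.
have -> : count (level 0) (pairsum (cls x) (cls (- y))) = (#|` cls x| * #|fiber y|)%N.
  rewrite count_pairsum (eq_big_seq (fun=> #|fiber y|)).
    by rewrite big_const_seq count_predT iter_addn_0 mulnC.
  move=> a ax; rewrite (seq.permP perm_opp) count_map card_fiber.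
  have yc := class_const_cls cls_schur y.
  rewrite -[y.1]/(x.1) (count_level_const cls_schur level0 yc ax).
  by apply: eq_count => b; rewrite /level /= subr_eq0 eq_sym.
by rewrite mod0n => /eqP.
Qed.

(** Let k be the number of fibres at the level of [x]. By coprimality every other fibre has at least
    |HH| points, so |fiber x| + (k - 1)|HH| <= p. There are at most k orbits, so p <= 1 + (k -
    1)|HH|. *)
Lemma card_fiber_coprime x : coprime #|` cls x| #|HH| -> ~~ full x.1 -> #|fiber x| = 1%N.
Proof.
move=> co nf; have x_eq : x = (x.1, x.2) by case: (x).
have le := leq_trans card_orbits (leq_add (leqnn 1)
  (leq_mul (leq_sub2r 1 (card_orbits_fibers nf)) (leqnn #|HH|))).
have : (#|fiber x| + (#|[set fiber (x.1, j) | j : 'Z_p]| - 1) * #|HH| <= p)%N.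
  apply: leq_trans (eq_leq (sum_card_fibers x.1)).
  rewrite (bigD1 (fiber x)) /=; last first.
    by rewrite {1}x_eq; apply: imset_f.
  rewrite leq_add2l (cardsD1 (fiber x)) {1}x_eq imset_f // addKn -sum_nat_const.
  rewrite [X in (X <= _)%N](eq_bigl (fun A : {set 'Z_p} =>
    (A \in [set fiber (x.1, j) | j : 'Z_p]) && (A != fiber x))); last first.
    by move=> A; rewrite in_setD1 andbC.
  apply: leq_sum => A /andP [/imsetP [j _ ->] ne].
  apply: dvdn_leq; first exact: card_fiber_gt0.
  rewrite -(@Gauss_dvdr _ #|` cls x|) 1?coprime_sym //; apply: dvdn_card_fiber.
  apply: contra ne => xj; apply/eqP; rewrite [in RHS]x_eq; apply: fiber_eq.
  by rewrite inE -x_eq.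
have := card_fiber_gt0 x; move: le; lia.
Qed.

End Counting.

(** * A class of at most two points at levels 1 and -1 *)

Section Generator.
Variables (p : nat) (cls : G p -> {fset G p}) (HH : {group {perm 'Z_p}}).
Hypothesis cls_schur : schur_classes cls.
Hypothesis cls_level0 : forall i (y : G p),
  y \in cls (0, i) <-> y.1 = 0 /\ exists2 h, h \in HH & h i = y.2.

Let labs := level_abs cls_schur (level0_stable cls_level0).

Definition symmetric_levels := forall x : G p, exists j, (- x.1, j) \in cls x.

Lemma card_cls_symmetric (x : G p) :
  symmetric_levels -> x.1 != 0 -> #|` cls x| = (#|fiber cls x|).*2.
Proof.
move=> sy x0; have [j xj] := sy x.
have ne : (x.1 == - x.1) = false by rewrite -addr_eq0 -mulr2n mulrn_eq0 (negPf x0).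
rewrite -addnn {2}card_fiber -(count_level_cls cls_schur cls_level0 xj) /=.
rewrite -(count_predC (level x.1)) addnC; congr (_ + _)%N; apply: eq_in_count => y xy.
by rewrite /level /=; case: (labs xy) => ->; rewrite ?eqxx ?ne // eq_sym ne.
Qed.

Lemma cls_eq_fiber1 (x y z : G p) : #|fiber cls x| = 1%N ->
  y \in cls x -> z \in cls x -> y.1 = z.1 -> y = z.
Proof.
move=> k1 xy xz e.
have := count_level_cls cls_schur cls_level0 xy.
rewrite k1 -(cls_eq cls_schur xy) -card_fiber => /eqP /cards1P [i fi].
have := mem_fiber cls_schur y; rewrite fi inE => /eqP y2.
have : z.2 \in fiber cls y.
  by rewrite inE e -surjective_pairing (cls_eq cls_schur xy).
by rewrite fi inE -y2 => /eqP z2; case: (y) (z) e z2 => ? ? [? ?] /= -> ->.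
Qed.

Lemma cls_fiber1 (x : G p) : #|fiber cls x| = 1%N ->
  exists x' : G p, x'.1 = - x.1 /\ forall y, y \in cls x -> y = x \/ y = x'.
Proof.
move=> k1; have xx := cls_refl cls_schur x.
(* In the discrete case [- x] is only a placeholder at the opposite level. *)
case: (level_dichotomy cls_schur (level0_stable cls_level0)) => [lA|lB].
  by exists (- x); split=> // y xy; left; apply: (cls_eq_fiber1 k1 xy xx (lA _ _ xy)).
have [j xj] := lB x; exists (- x.1, j); split=> // y xy.
by case: (labs xy) => e; [left | right];
  [apply: (cls_eq_fiber1 k1 xy xx e) | apply: (cls_eq_fiber1 k1 xy xj e)].
Qed.

(** Used to discard the mixed sums of a multiple of [x] with [x'], or of [x'] with [x]: their level
    is not that of the class of the next multiple, up to sign. *)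
Lemma mixed_level (a : int) n : a != 0 ->
  a *+ n.+1 - a <> a *+ n.+1 + a /\ a *+ n.+1 - a <> - (a *+ n.+1 + a).
Proof.
move=> a0; rewrite -mulrSr [in X in X - a]mulrSr addrK; split=> /eqP.
  by rewrite !mulrSr -addrA -subr_eq0 opprD addrA subrr add0r oppr_eq0 -mulr2n mulrn_eq0 (negPf a0).
by rewrite -addr_eq0 -mulrnDr mulrn_eq0 (negPf a0) addnS.
Qed.

Lemma cls_mulrn (x x' : G p) n y : x.1 != 0 -> x'.1 = - x.1 ->
  (forall z, z \in cls x -> z = x \/ z = x') ->
  y \in cls (x *+ n) -> y = x *+ n \/ y = x' *+ n.
Proof.
move=> x0 x'1 cx; elim: n y => [|n IHn] y.
  by rewrite (cls_0 cls_schur) inE => /eqP ->; left.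
rewrite mulrSr => xy; have := labs xy.
have [a [b [ha hb e]]] := pairsum_cls_sub cls_schur xy
  (cls_refl cls_schur _) (cls_refl cls_schur _) erefl.
case: n => [|n] in IHn xy ha e *.
  move: ha; rewrite (cls_0 cls_schur) inE => /eqP a0.
  by rewrite e a0 !mulr1n !mulr0n !add0r => _; case: (cx _ hb) => ->; [left|right].
rewrite [x' *+ n.+2]mulrSr e.
have fstM (z : G p) k : (z *+ k).1 = z.1 *+ k by rewrite raddfMn.
case: (IHn _ ha) => ->; case: (cx _ hb) => ->; rewrite /= !fstM ?x'1; [by left| | |by right].
- by have [n1 n2] := mixed_level n x0; case.
- have [n1 n2] := mixed_level n x0; rewrite mulNrn => -[e'|e']; exfalso.
    by apply: n2; rewrite -e' opprD opprK.
  by apply: n1; apply: oppr_inj; rewrite -e' opprD opprK.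
Qed.

Hypothesis p_pr : prime p.
Hypothesis no_full : forall n, ~~ full cls n.

(** A multiple of [x] reaches a level 1 + lp, and adding (-lp, 0), whose class is known from
    [cls_mulp], brings it to level 1. *)
Lemma generator (x : G p) : ~~ (p %| `|x.1|)%N -> #|fiber cls x| = 1%N ->
  exists w w' : G p, [/\ w.1 = 1, w'.1 = -1 &
    forall y, y \in cls w -> y = w \/ y = w'].
Proof.
move=> px k1; have [x' [x'1 cx]] := cls_fiber1 k1.
have x0 : x.1 != 0 by apply: contraNneq px => ->; rewrite dvdn0.
have p_gt1 := prime_gt1 p_pr.
have [q [l ql]] : exists (q : nat) (l : int), x.1 *+ q = 1 + l *+ p.
  have co : coprimez x.1 p%:Z.
    by rewrite coprimezE /= coprime_sym prime_coprime.
  have [[u v] /= uv] := coprimezP _ _ co.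
  (* [u] inverts [x.1] mod p; its remainder is taken because [cls_mulrn] is about natural multiples,
     and [l] absorbs the quotient. *)
  exists `|(u %% p%:Z)%Z|%N, (- v - (u %/ p%:Z)%Z * x.1).
  have -> : x.1 *+ `|(u %% p%:Z)%Z| = x.1 * (u %% p%:Z)%Z.
    by rewrite -mulr_natr natz gez0_abs // modz_ge0; lia.
  have := divz_eq u p%:Z; rewrite -[_ *+ p]mulr_natr natz.
  by move: (u %% p%:Z)%Z (u %/ p%:Z)%Z => r d; move: uv; nia.
have fstM (z : G p) k : (z *+ k).1 = z.1 *+ k by rewrite raddfMn.
exists (x *+ q + (- l *+ p, 0)), (x' *+ q + (l *+ p, 0)); split.
- by rewrite /= fstM ql mulNrn addrK.
- by rewrite /= fstM x'1 mulNrn ql opprD subrK.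
move=> y xy; have /= := labs xy; rewrite fstM ql mulNrn addrK.
have [a [b [ha hb ->]]] := pairsum_cls_sub cls_schur xy
  (cls_refl cls_schur _) (cls_refl cls_schur _) erefl.
(* Mixed sums lie at level 1 + 2lp or its negative. This is 1 or -1 only if lp is 0, where they
   agree with the pure sums, or -1, which is excluded since p > 1. *)
have l2 : l *+ p = 0 \/ (1 < `|l *+ p|)%N.
  case: (eqVneq l 0) => [->|l0]; first by left; rewrite mul0rn.
  right; rewrite -mulr_natr natz abszM absz_nat.
  by apply: leq_trans p_gt1 (leq_pmull _ _); rewrite absz_gt0.
case: (cls_mulrn x0 x'1 cx ha) => ->;
case: (cls_mulp p_pr cls_schur cls_level0 (no_full _) hb) => ->;
 rewrite /= ?fstM ?x'1 ?mulNrn ?ql ?opprK;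
 move=> lev.
- by left.
- left; congr (_ + (_, _)); move: lev l2; lia.
- right; congr (_ + (_, _)); move: lev l2; lia.
- by right.
Qed.

End Generator.

(** * Classes as orbits *)

Section Orbits.
Variables (p : nat) (cls : G p -> {fset G p}) (HH : {group {perm 'Z_p}}).
Hypothesis cls_schur : schur_classes cls.
Hypothesis HH_aut : (HH \subset Aut [set: 'Z_p])%g.
Hypothesis cls_level0 : forall i (y : G p),
  y \in cls (0, i) <-> y.1 = 0 /\ exists2 h, h \in HH & h i = y.2.
Variables (w w' : G p).
Hypothesis w_1 : w.1 = 1.
Hypothesis w'_1 : w'.1 = -1.
Hypothesis cls_w : forall y, y \in cls w -> y = w \/ y = w'.
Hypothesis odd_HH : symmetric_levels cls -> odd #|HH|.

Let labs := level_abs cls_schur (level0_stable cls_level0).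
Local Notation symm := (symmetric_levels cls).

Lemma cls_mulrz l y : y \in cls (w *~ l) -> y = w *~ l \/ y = w' *~ l.
Proof.
have w0 : w.1 != 0 by rewrite w_1.
have w'w : w'.1 = - w.1 by rewrite w_1.
have nat_case (n : nat) z : z \in cls (w *~ n) -> z = w *~ n \/ z = w' *~ n.
  by rewrite -!pmulrn; apply: cls_mulrn.
case: l => n; first exact: nat_case.
rewrite NegzE !mulrNz => /(cls_opp cls_schur); rewrite opprK => /nat_case [] e.
  by left; rewrite -e opprK.
by right; rewrite -e opprK.
Qed.

Lemma mulrz_1 (x : G p) l : (x *~ l).1 = x.1 *~ l.
Proof. by case: l => n; rewrite ?NegzE ?mulrNz -!pmulrn /= raddfMn. Qed.

Lemma w_mulrz_1 l : (w *~ l).1 = l.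
Proof. by rewrite mulrz_1 w_1 intz. Qed.

Lemma w'_mulrz_1 l : (w' *~ l).1 = - l.
Proof. by rewrite mulrz_1 w'_1 mulNrz intz. Qed.

(* [x = x.1 w + wcoord x] in the decomposition of G as <w> x Z_p, and [wauto b h] is
   the automorphism acting as [h] on Z_p and sending [w] to [w] or [w']. *)
Definition wcoord (x : G p) : 'Z_p := x.2 - w.2 *~ x.1.

Lemma wcoordE x : x = w *~ x.1 + (0, wcoord x).
Proof.
have w2 l : (w *~ l).2 = w.2 *~ l by case: l => n; rewrite ?NegzE ?mulrNz -!pmulrn /= raddfMn.
rewrite [LHS]surjective_pairing [RHS]surjective_pairing /= w2 w_mulrz_1 addr0.
by rewrite /wcoord addrC subrK.
Qed.

Lemma symm_w' : symm -> w' \in cls w.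
Proof.
move=> sy; have [j wj] := sy w; case: (cls_w wj) => e; last by rewrite -e.
by have := congr1 fst e; rewrite /= w_1.
Qed.

(** The point w + w' lies at level 0, so its class is an [HH]-orbit. That class is contained in {w,
    w'} + {w, w'}, whose only point at level 0 is w + w' itself. *)
Lemma HH_fix_ww' h : symm -> h \in HH -> h (w.2 + w'.2) = w.2 + w'.2.
Proof.
move=> sy hH; have w'w := symm_w' sy.
have ww' : w + w' = (0, w.2 + w'.2).
  by rewrite [LHS]surjective_pairing /= w_1 w'_1.
have hz : (0, h (w.2 + w'.2)) \in cls (w + w').
  by rewrite ww'; apply/cls_level0; split=> //; exists h.
have [a [b [ha hb e]]] := pairsum_cls_sub cls_schur hz
  (cls_refl cls_schur _) (cls_refl cls_schur _) erefl.
rewrite (cls_eq cls_schur w'w) in hb.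
have := congr1 fst e; have := congr1 snd e.
case: (cls_w ha) => ->; case: (cls_w hb) => -> /=; rewrite ?w_1 ?w'_1 //.
by rewrite addrC.
Qed.

Lemma cls_coord_sub x y : y \in cls x ->
  exists2 h, h \in HH & y = w *~ x.1 + (0, h (wcoord x)) \/
    y = w' *~ x.1 + (0, h (wcoord x)).
Proof.
rewrite {1}(wcoordE x) => xy.
have [a [b [ha hb ->]]] := pairsum_cls_sub cls_schur xy
  (cls_refl cls_schur _) (cls_refl cls_schur _) erefl.
case/cls_level0: hb => b1 [h hH hb2]; exists h => //.
have -> : b = (0, h (wcoord x)) by rewrite [b]surjective_pairing b1 hb2.
by case: (cls_mulrz ha) => ->; [left | right].
Qed.

(** Here the point -lw, with l = [x.1], is a class by itself. Translating [cls x] by it gives a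
    class-constant set containing (0, [wcoord x]), hence the whole [HH]-orbit. *)
Lemma cls_coord_sup_discrete x h : (forall x y : G p, y \in cls x -> y.1 = x.1) ->
  h \in HH -> w *~ x.1 + (0, h (wcoord x)) \in cls x.
Proof.
move=> lA hH; pose o := wcoord x.
have cst := class_const_pairsum cls_schur
  (class_const_cls cls_schur x) (class_const_cls cls_schur (- (w *~ x.1))).
have h0 : (0, h o) \in cls (0, o) by apply/cls_level0; split=> //; exists h.
have : (0, h o) \in pairsum (cls x) (cls (- (w *~ x.1))).
  apply: (class_const_mem cst h0); apply/allpairsP; exists (x, - (w *~ x.1)).
  rewrite !cls_refl //; split=> //=; apply/eqP.
  by rewrite eq_sym subr_eq addrC; apply/eqP/wcoordE.
case/allpairsP => -[a b] /= [ax bw e].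
have bE : b = - (w *~ x.1).
  have b1 := lA _ _ bw; move: bw b1; rewrite -mulrNz => bw.
  case: (cls_mulrz bw) => // ->; rewrite w'_mulrz_1 w_mulrz_1 => x0.
  by have -> : x.1 = 0 by lia.
by rewrite e bE addrCA subrr addr0.
Qed.

Lemma cls_coord_sup_symm x h : symm -> h \in HH ->
  w *~ x.1 + (0, h (wcoord x)) \in cls x /\ w' *~ x.1 + (0, h (wcoord x)) \in cls x.
Proof.
move=> sy; set l := x.1; set o := wcoord x.
have hO g i : g \in HH -> (0, g i) \in cls (0, i).
  by move=> gH; apply/cls_level0; split=> //; exists g.
case: (eqVneq l 0) => [l0|l0] hH.
  have xE : x = (0, o) by rewrite [LHS]wcoordE -/l -/o l0 mulr0z add0r.
  by rewrite l0 !mulr0z add0r {1 2}xE hO.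
have w'w := symm_w' sy.
(* For nonzero [l] these two points form one class. Multiplying [cls x] by it brings the parts at
   levels l and -l down to level 0, where classes are orbits. *)
pose F := [:: - (w *~ l); - (w' *~ l)].
have F_const : class_const cls F.
  have : perm_eq (cls (- (w *~ l))) F.
    apply: uniq_perm; rewrite ?fset_uniq //=.
      rewrite inE andbT; apply/eqP => /(congr1 fst) /=.
      by rewrite w_mulrz_1 w'_mulrz_1; lia.
    move=> y; rewrite !inE; apply/idP/idP.
      rewrite -mulrNz => /cls_mulrz [] ->; by rewrite !mulrNz eqxx ?orbT.
    case/orP=> /eqP ->; first exact: cls_refl.
    apply: (cls_opp cls_schur).
    have [j wj] := sy (w *~ l); have [e|<- //] := cls_mulrz wj.
    by have := congr1 fst e; rewrite /= w_mulrz_1; lia.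
  by move/class_const_perm; apply; apply: class_const_cls.
have E_const := class_const_cls cls_schur x.
have cst := class_const_pairsum cls_schur F_const E_const.
(* [f] is constant on the orbit of [o], vanishes off it, and sums to twice the fibre
   size; as the orbit is odd, its value there is even, hence the maximum 2. *)
pose al j : nat := (w *~ l + (0, j) \in cls x).
pose be j : nat := (w' *~ l + (0, j) \in cls x).
pose f (j : 'Z_p) := count_mem ((0, j) : G p) (pairsum F (cls x)).
have fE j : f j = (al j + be j)%N.
  rewrite /f count_mem_pairsum !big_cons big_nil addn0 2!opprK 2!count_mem_fset.
  by rewrite [(0, j) + w *~ l]addrC [(0, j) + w' *~ l]addrC.
have f_orb g j : g \in HH -> f (g j) = f j by move=> gH; apply/esym/cst/hO.
have sum_side (v : G p) : (\sum_(j : 'Z_p) ((v + (0, j))%R \in cls x) =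
    count (level v.1) (cls x))%N.
  rewrite count_level_sum [RHS](reindex_inj (addrI v.2)) /=; apply: eq_bigr => j _.
  by rewrite [v + _]surjective_pairing /= addr0 count_mem_fset.
have sum_f : (\sum_(j : 'Z_p) f j = (#|fiber cls x|).*2)%N.
  rewrite (eq_bigr _ (fun j _ => fE j)) big_split /= !sum_side w_mulrz_1 w'_mulrz_1.
  have [j xj] := sy x.
  rewrite card_fiber -/l (count_level_const cls_schur (level0_stable cls_level0) E_const xj) /=.
  by rewrite addnn.
have supp j : j \notin orbit 'P%act HH o -> f j = 0%N.
  move=> jO; have no v : v = w \/ v = w' -> v *~ l + (0, j) \notin cls x.
    move=> hv; apply: contra jO => /cls_coord_sub [g gH]; rewrite -/l -/o => e.
    apply/orbitP; exists g => //; rewrite /= apermE.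
    have lev : (v *~ l).1 = l \/ (v *~ l).1 = - l.
      by case: hv => ->; rewrite ?w_mulrz_1 ?w'_mulrz_1; [left|right].
    case: hv => hv; rewrite hv in e *; case: e => e.
    + by case: (addrI _ e).
    + by have := congr1 fst e; rewrite /= w_mulrz_1 w'_mulrz_1; lia.
    + by have := congr1 fst e; rewrite /= w_mulrz_1 w'_mulrz_1; lia.
    + by case: (addrI _ e).
  by rewrite fE /al /be !(negPf (no _ _)); auto.
have sum_f' : (\sum_(j : 'Z_p) f j = #|orbit 'P%act HH o| * f o)%N.
  rewrite (bigID (mem (orbit 'P%act HH o))) /= [X in (_ + X)%N]big1 // addn0.
  rewrite -sum_nat_const; apply: eq_bigr => j /orbitP [g gH <-].
  exact: f_orb.
have odd_orb : odd #|orbit 'P%act HH o|.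
  exact: dvdn_odd (dvdn_orbit _ _ _) (odd_HH sy).
have f_even : ~~ odd (f o).
  have := congr1 odd sum_f'; rewrite sum_f odd_double oddM odd_orb /=.
  by case: (odd _).
have al_o : al o = 1%N by rewrite /al -wcoordE cls_refl.
have f_ho : f (h o) = 2.
  by rewrite f_orb //; move: f_even; rewrite fE al_o /be; case: (_ \in _).
move: f_ho; rewrite fE /al /be.
by case: (w *~ l + _ \in cls x); case: (w' *~ l + _ \in cls x).
Qed.

Definition wauto (b : bool) (h : {perm 'Z_p}) (x : G p) : G p :=
  (if b then w' else w) *~ x.1 + (0, h (wcoord x)).

Lemma clsE x y : y \in cls x <->
  exists (b : bool) (h : {perm 'Z_p}), [/\ (b -> symm), h \in HH & y = wauto b h x].
Proof.
case: (level_dichotomy cls_schur (level0_stable cls_level0)) => [lA|sy]; split.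
- move=> xy; have [h hH e] := cls_coord_sub xy; exists false, h; split=> //.
  case: e => // e; have := lA _ _ xy; rewrite e /= w'_mulrz_1 addr0 => x0.
  by rewrite /wauto; have -> : x.1 = 0 by lia.
- move=> [b [h [bs hH ->]]]; case: b bs => bs; last exact: cls_coord_sup_discrete.
  by case: (cls_coord_sup_symm x (bs isT) hH).
- move=> xy; have [h hH [e|e]] := cls_coord_sub xy; [exists false, h | exists true, h];
  by split.
- move=> [b [h [bs hH ->]]]; have [] := cls_coord_sup_symm x sy hH.
  by rewrite /wauto; case: (b).
Qed.

Lemma HH_D h x y : h \in HH -> h (x + y) = h x + h y.
Proof.
move=> hH; rewrite (HH_mul HH_aut (x + y) hH) (HH_mul HH_aut x hH) (HH_mul HH_aut y hH).
by rewrite mulrDl.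
Qed.

Lemma wautoD b h x y : h \in HH -> wauto b h (x + y) = wauto b h x + wauto b h y.
Proof.
move=> hH; rewrite /wauto /= mulrzDr addrACA; congr (_ + _).
have -> : wcoord (x + y) = wcoord x + wcoord y.
  by rewrite /wcoord /= mulrzDr opprD addrACA.
by rewrite HH_D //; congr pair; rewrite addr0.
Qed.

Lemma wautoMz b h x l : h \in HH -> wauto b h (x *~ l) = wauto b h x *~ l.
Proof.
move=> hH; have w0 : wauto b h 0 = 0.
  by apply: (addrI (wauto b h 0)); rewrite -wautoD // !addr0.
have wN y : wauto b h (- y) = - wauto b h y.
  by apply: (addrI (wauto b h y)); rewrite -wautoD // !subrr.
have wn y n : wauto b h (y *+ n) = wauto b h y *+ n.
  by elim: n => [|n IHn]; rewrite ?mulr0n // !mulrS wautoD // IHn.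
by case: l => n; rewrite ?NegzE ?mulrNz -!pmulrn ?wN wn.
Qed.

Lemma wauto_w b h : h \in HH -> wauto b h w = if b then w' else w.
Proof.
move=> hH; rewrite /wauto /wcoord w_1 !mulr1z subrr.
by rewrite (HH_mul HH_aut _ hH) mul0r addr0.
Qed.

Lemma wauto_level0 b h i : wauto b h (0, i) = (0, h i).
Proof. by rewrite /wauto /wcoord /= !mulr0z subr0 add0r. Qed.

(** Since w' is -w plus an element of Z_p fixed by [HH], sending w to w' sends w' back to w. This
    makes the maps [wauto] closed under composition. *)
Lemma wauto_w' b h : symm -> h \in HH -> wauto b h w' = if b then w else w'.
Proof.
move=> sy hH; have vE : w' = - w + (0, w.2 + w'.2).
  by rewrite [RHS]surjective_pairing /= w_1 addr0 addKr -w'_1 -surjective_pairing.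
rewrite {1}vE wautoD // wauto_level0 HH_fix_ww' //.
rewrite -[- w]mulrN1z wautoMz // wauto_w // mulrN1z.
case: b; last by rewrite -vE.
by rewrite {1}vE opprD opprK subrK.
Qed.

Lemma wauto_comp (b : bool) h (b' : bool) h' x : (is_true b' -> symm) -> h \in HH -> h' \in HH ->
  wauto b h (wauto b' h' x) = wauto (b (+) b') (h' * h)%g x.
Proof.
move=> b's hH h'H; rewrite {2}/wauto wautoD // wautoMz // wauto_level0.
rewrite [RHS]/wauto permM; congr (_ *~ _ + _).
by case: b' b's => b's; [rewrite (wauto_w' _ (b's isT) hH) | rewrite wauto_w //]; case: (b).
Qed.

Lemma wauto1 x : wauto false 1%g x = x.
Proof. by rewrite /wauto perm1 -wcoordE. Qed.

Definition wauts (s : G p -> G p) :=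
  exists (b : bool) (h : {perm 'Z_p}), [/\ (b -> symm), h \in HH & s =1 wauto b h].

Lemma wauts_finite_aut_subgroup : finite_aut_subgroup wauts.
Proof.
have inv (b : bool) (h : {perm 'Z_p}) : h \in HH -> (b -> symm) ->
    cancel (wauto b h) (wauto b h^-1%g) /\ cancel (wauto b h^-1%g) (wauto b h).
  move=> hH bs; split=> x; rewrite wauto_comp ?groupV // addbb.
    by rewrite mulgV wauto1.
  by rewrite mulVg wauto1.
split.
- move=> s [b [h [bs hH e]]]; split=> [x y|]; first by rewrite !e wautoD.
  have [c1 c2] := inv b h hH bs.
  by exists (wauto b h^-1%g) => x; rewrite ?e.
- by exists false, 1%g; split=> // x; rewrite wauto1.
- move=> s t [b [h [bs hH e]]] [b' [h' [bs' hH' e']]].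
  exists (b (+) b'), (h' * h)%g; split; [|exact: groupM|].
    by case: (b) bs; case: (b') bs'.
  by move=> x /=; rewrite e e' wauto_comp.
- move=> s [b [h [bs hH e]]]; have [c1 c2] := inv b h hH bs.
  exists (wauto b h^-1%g); split=> [||x].
  + by exists b, h^-1%g; rewrite groupV.
  + by move=> x; rewrite e.
  + by rewrite e.
(* The enumeration runs over all permutations; it only has to cover [wauts]. *)
exists #|{: bool * {perm 'Z_p}}|, (fun i => wauto (enum_val i).1 (enum_val i).2).
move=> s [b [h [_ _ e]]]; exists (enum_rank (b, h)) => x.
by rewrite enum_rankK e.
Qed.

Lemma wauts_invariant (F : eqType) (f : G p -> F) :
  (forall x y, y \in cls x -> f x = f y) <-> (forall s, wauts s -> forall x, f (s x) = f x).
Proof.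
split=> [h s [b [g [bs gH e]]] x|h x y].
  by rewrite e; apply/esym/h/clsE; exists b, g.
case/clsE => b [g [bs gH ->]]; apply/esym/(h (wauto b g)).
by exists b, g.
Qed.

End Orbits.

(** * The theorem *)

Section SchurPartition.
Variables (p : nat) (F : fieldType) (D : {fset G p} -> Prop).

Lemma cprodE (C E : {fset G p}) x :
  Defs.cprod F C E x = (count_mem x (pairsum C E))%:R.
Proof.
rewrite count_pairsum natr_sum; apply: eq_bigr => c _.
by rewrite count_sum natr_sum.
Qed.

(** The span condition makes the product coefficients constant on classes as elements of [F];
    characteristic 0 lifts this to the natural counts. *)
Lemma schur_partition_classes : [pchar F] =i pred0 -> schur_partition F D ->
  exists cls : G p -> {fset G p}, [/\ schur_classes cls, (forall x, D (cls x)) &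
    forall C x, D C -> x \in C -> C = cls x].
Proof.
move=> char0 [[D_neq0 D_cover D_inj] D0 Dinv Dmul].
have [cls cls_D] := boolp.choice D_cover.
have clsD C x : D C -> x \in C -> C = cls x.
  by move=> DC xC; case: (cls_D x) => Dx xx; apply: D_inj DC Dx xC xx.
exists cls; split=> // [|x]; last by case: (cls_D x).
split.
- by move=> x; case: (cls_D x).
- by move=> x y xy; apply/esym/clsD => //; case: (cls_D x).
- by apply/esym/clsD => //; rewrite inE.
- move=> x y xy; have [Dx xx] := cls_D x.
  rewrite -(clsD _ (- x) (Dinv _ Dx)); apply/imfsetP; [by exists y | by exists x].
- move=> x y z z' zz'.
  have [Dx _] := cls_D x; have [Dy _] := cls_D y.
  have [l [lD lE]] := Dmul _ _ Dx Dy.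
  have : Defs.cprod F (cls x) (cls y) z = Defs.cprod F (cls x) (cls y) z'.
    rewrite !lE; apply: eq_big_seq => q /lD Dq; congr (_ * _%:R).
    have [Dz zz] := cls_D z.
    congr nat_of_bool; apply/idP/idP => h; first by rewrite (clsD _ _ Dq h).
    by rewrite (D_inj _ _ _ Dq Dz h zz').
  rewrite !cprodE => /eqP; rewrite -subr_eq0 => e0; apply/eqP; move: e0.
  have /pcharf0P natr0 := char0.
  (* Ordering the two counts lets their difference be taken in the natural numbers. *)
  wlog le : z z' {zz'} / (count_mem z' (pairsum (cls x) (cls y)) <=
                          count_mem z (pairsum (cls x) (cls y)))%N.
    move=> W; case/orP: (leq_total (count_mem z' (pairsum (cls x) (cls y)))
      (count_mem z (pairsum (cls x) (cls y)))) => h; first exact: W.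
    by rewrite -opprB oppr_eq0 [X in _ -> is_true X]eq_sym; apply: W.
  by rewrite -natrB // natr0 subn_eq0 eqn_leq le andbT.
Qed.

Variable cls : G p -> {fset G p}.
Hypothesis cls_schur : schur_classes cls.
Hypothesis cls_D : forall x, D (cls x).
Hypothesis D_cls : forall C x, D C -> x \in C -> C = cls x.

(** For the converse, induct on a list containing the support: subtracting [f x] times the sum of
    the class of the head [x] clears that class. *)
Lemma in_spanP (f : G p -> F) :
  in_span D f <-> Defs.finsupp f /\ forall x y, y \in cls x -> f x = f y.
Proof.
split=> [[l [lD lE]]|[[s]]].
  split=> [|x y xy].
    exists (flatten [seq enum_fset q.1 | q <- l]) => x; apply: contraNT => xl.
    rewrite lE big1_seq // => q /andP [_ ql]; rewrite /csum.
    case: (boolP (x \in q.1)) => [xq|]; last by rewrite mulr0.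
    case/negP: xl; apply/flattenP; exists (enum_fset q.1) => //.
    exact: (map_f (fun q : {fset G p} * F => enum_fset q.1) ql).
  rewrite !lE; apply: eq_big_seq => q /lD Dq; congr (_ * _%:R).
  congr nat_of_bool; apply/idP/idP => h; first by rewrite (D_cls Dq h).
  by rewrite (D_cls Dq h) cls_sym.
elim: s f => [|x s IHs] f f_s f_const.
  exists [::]; split=> // x; rewrite big_nil; apply/eqP; apply: contraT => /f_s.
  by rewrite in_nil.
have csum_const y z : z \in cls y -> csum F (cls x) y = csum F (cls x) z.
  move=> yz; congr (_%:R); have := class_const_cls cls_schur x yz.
  by rewrite !count_mem_fset.
have [||l [lD lE]] := IHs (fun y => f y - f x * csum F (cls x) y).
- move=> y; apply: contraNT => ys; case: (boolP (y \in cls x)) => [yx|nyx].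
    by rewrite /csum yx mulr1 (f_const _ _ yx) subrr.
  rewrite /csum (negPf nyx) mulr0 subr0; apply: contraT => /f_s.
  rewrite inE (negPf ys) orbF => /eqP yx; case/negP: nyx; rewrite yx.
  exact: cls_refl.
- by move=> y z yz; rewrite (f_const _ _ yz) (csum_const _ _ yz).
exists ((cls x, f x) :: l); split=> [q|y].
  by rewrite inE => /predU1P [->|/lD //]; apply: cls_D.
by rewrite big_cons -lE /= addrC subrK.
Qed.

(** Take Z_p for K and the union of the non-full levels for L. A class outside L contains every
    level that it meets. *)
Lemma wedge_product_full (HH : {group {perm 'Z_p}}) n : prime p ->
  (forall i (y : G p),
     y \in cls (0, i) <-> y.1 = 0 /\ exists2 h, h \in HH & h i = y.2) ->
  full cls n -> wedge_product D.
Proof.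
move=> p_pr cls0 fn; have level0 := level0_stable cls0.
exists (fun x => x.1 = 0), (fun x => ~~ full cls x.1); split.
- split.
  + split; first by split=> // [x y|x] /= -> // ->.
    by move=> C x y DC xC; rewrite (D_cls DC xC); apply: level0.
  + split.
      split; first exact: full0.
        by move=> x y; apply: (fullD p_pr cls_schur cls0).
      by move=> x; apply: contraNN => /(fullN cls_schur); rewrite /= opprK.
    move=> C x y DC xC yC; apply: contraNN.
    by apply: (full_cls cls_schur cls0); rewrite -(D_cls DC yC).
  + by move=> x ->; apply: full0.
- by exists (0, 1); split=> //; rewrite xpair_eqE oner_eq0 andbF.
- by exists (n, 0); rewrite fn.
move=> C DC nL x k xC k0.
rewrite (D_cls DC xC) [x + k]surjective_pairing /= k0 addr0.
case: x xC => a i xC /=; apply: (fullP cls_schur).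
by have := nL _ xC; move/negP; rewrite negbK.
Qed.

End SchurPartition.

(** * The subring over Z_p and the maximal subgroup H *)

Section Hypotheses.
Variables (p : nat) (F : fieldType) (D : {fset G p} -> Prop) (cls : G p -> {fset G p}).
Hypothesis cls_schur : schur_classes cls.
Hypothesis cls_D : forall x, D (cls x).
Hypothesis D_cls : forall C x, D C -> x \in C -> C = cls x.

(** The description of T(S) is tested on three indicator functions: of level 0, of an [HH]-orbit and
    of a class at level 0. *)
Lemma cls_level0_orbit (HH : {group {perm 'Z_p}}) :
  (forall f : G p -> F, (schur_ring F D f /\ in_FZp f) <-> fixed_FZp HH f) ->
  forall i (y : G p), y \in cls (0, i) <-> y.1 = 0 /\ exists2 h, h \in HH & h i = y.2.
Proof.
move=> T_fixed i y; have const_S (f : G p -> F) := in_spanP cls_schur cls_D D_cls f.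
have bool_inj (a b : bool) : a%:R = b%:R :> F -> a = b.
  by case: a; case: b => // /eqP; rewrite ?oner_eq0 // eq_sym oner_eq0.
have fixed_const (f : G p -> bool) x z : z \in cls x ->
    fixed_FZp HH (fun u => (f u)%:R : F) -> f x = f z.
  move=> xz /T_fixed [/const_S [_ f_const] _].
  exact: bool_inj (f_const _ _ xz).
have level0 (x z : G p) : z \in cls x -> x.1 = 0 -> z.1 = 0.
  move=> xz x0; have := fixed_const (fun u => u.1 == 0) _ _ xz; rewrite x0 eqxx => e.
  by apply/esym/eqP; rewrite eq_sym -e //; split=> // u /negPf ->.
split=> [xy|[y0 [h hH hi]]].
  have y0 := level0 _ _ xy erefl; split=> //.
  have := fixed_const (fun u => (u.1 == 0) && (u.2 \in orbit 'P%act HH i)) _ _ xy.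
  rewrite y0 eqxx /= orbit_refl => e.
  have /orbitP [h hH hi] : y.2 \in orbit 'P%act HH i.
    rewrite -e //; split=> [u /negPf -> //|h hH k] /=.
    have e' : orbit 'P%act HH (h k) = orbit 'P%act HH k by exact: orbit_act.
    by rewrite orbit_sym e' orbit_sym.
  by exists h.
have [_ /(_ h hH i)] : fixed_FZp HH (csum F (cls (0, i))).
  apply/T_fixed; split=> [|x x0].
    exists [:: (cls (0, i), 1)]; split=> [q|x]; first by rewrite inE => /eqP ->; apply: cls_D.
    by rewrite big_seq1 mul1r.
  rewrite /csum; case: (boolP (x \in _)) => // /level0 /(_ erefl) e.
  by rewrite e eqxx in x0.
rewrite hi -y0 -surjective_pairing /csum => /bool_inj ->.
exact: cls_refl.
Qed.

(** By [cls_mulp] the subgroup H + pZ is again a union of classes inside Z, so maximality puts it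
    inside H. *)
Lemma mulp_in_maximal (H : G p -> Prop) (HH : {group {perm 'Z_p}}) : prime p ->
  (forall i (y : G p),
     y \in cls (0, i) <-> y.1 = 0 /\ exists2 h, h \in HH & h i = y.2) ->
  (forall n, ~~ full cls n) ->
  S_subgroup D H -> (forall x : G p, H x -> x.2 = 0) ->
  (forall K : G p -> Prop, S_subgroup D K -> (forall x : G p, K x -> x.2 = 0) ->
     (forall x, H x -> K x) -> forall x, K x -> H x) ->
  forall l : int, H (l *+ p, 0).
Proof.
move=> p_pr cls0 nf [[H0 HD HN] H_D] H2 H_max l.
pose K (x : G p) := exists (a : G p) (k : int), H a /\ x = a + (k *+ p, 0).
apply: (H_max K); last 1 first.
- by exists 0, l; rewrite add0r.
- split; first split.
  + by exists 0, 0; rewrite add0r mul0rn.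
  + move=> _ _ [a [k [Ha ->]]] [b [m [Hb ->]]]; exists (a + b), (k + m).
    split; first exact: HD.
    by rewrite addrACA mulrnDl; congr (_ + _); congr pair; rewrite addr0.
  + move=> _ [a [k [Ha ->]]]; exists (- a), (- k); split; first exact: HN.
    by rewrite opprD mulNrn; congr (_ + _); congr pair; rewrite oppr0.
  move=> C x y DC xC yC [a [k [Ha xE]]].
  rewrite (D_cls DC xC) xE in yC.
  have [b [c [ab ck ->]]] := pairsum_cls_sub cls_schur yC
    (cls_refl cls_schur _) (cls_refl cls_schur _) erefl.
  have Hb : H b := H_D _ _ _ (cls_D a) (cls_refl cls_schur a) ab Ha.
  by case: (cls_mulp p_pr cls_schur cls0 (nf _) ck) => ->; [exists b, k | exists b, (- k)].
- by move=> _ [a [k [Ha ->]]]; rewrite /= (H2 _ Ha) addr0.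
- by move=> x Hx; exists x, 0; rewrite mul0rn addr0.
Qed.

End Hypotheses.

Theorem theorem3p7 (p : nat) (F : fieldType)
  (D : {fset G p} -> Prop) (H : G p -> Prop) (HH : {group {perm 'Z_p}}) :
  prime p ->
  [pchar F] =i pred0 ->
  schur_partition F D ->
  (* H is the maximal S-subgroup contained in Z = {(n,0)} *)
  S_subgroup D H ->
  (forall x : G p, H x -> x.2 = 0) ->
  (forall K : G p -> Prop, S_subgroup D K -> (forall x : G p, K x -> x.2 = 0) ->
     (forall x, H x -> K x) -> forall x, K x -> H x) ->
  (* T(S) = S \cap F[Z_p] = F[Z_p]^HH with HH <= Aut(Z_p), m = #|HH| *)
  (HH \subset Aut [set: 'Z_p])%g ->
  (forall f : G p -> F,
     (schur_ring F D f /\ in_FZp f) <-> fixed_FZp (HH : {set {perm 'Z_p}}) f) ->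
  (* an S-class C outside H x Z_p with gcd(|C|, m) = 1 *)
  (exists C : {fset G p}, [/\ D C,
      (forall x, x \in C -> ~ H (x.1, 0)) &
      coprime #|` C| #|HH|]) ->
  wedge_product D \/ automorphic F D.
Proof.
move=> p_pr char0 D_schur H_sub H2 H_max HH_aut T_fixed [C [DC CH co]].
have [cls [cls_schur cls_D D_cls]] := schur_partition_classes char0 D_schur.
have cls0 := cls_level0_orbit cls_schur cls_D D_cls T_fixed.
case: (boolp.EM (exists n, full cls n)) => [[n fn]|nfull]; [left | right].
  exact: (wedge_product_full cls_schur D_cls p_pr cls0 fn).
have nf n : ~~ full cls n by apply/negP => fn; apply: nfull; exists n.
have pH := mulp_in_maximal cls_schur cls_D D_cls p_pr cls0 nf H_sub H2 H_max.
have [x xC] : exists x, x \in C.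
  by case: D_schur => -[/(_ C DC) C0 _ _] _ _ _; apply/fset0Pn.
have Hx := CH _ xC; rewrite (D_cls _ _ DC xC) in co.
(* C avoids H x Z_p, and H contains pZ. *)
have px : ~~ (p %| `|x.1|)%N.
  apply/negP => /dvdnP [k xk]; apply: Hx; case: (leP 0 x.1) => x0.
    have -> : x.1 = k%:Z *+ p by rewrite -mulr_natr natz; lia.
    exact: pH.
  have -> : x.1 = (- k%:Z) *+ p by rewrite -mulr_natr natz; lia.
  exact: pH.
have k1 := card_fiber_coprime p_pr cls_schur cls0 HH_aut co (nf _).
have [w [w' [w1 w'1 cls_w]]] := generator cls_schur cls0 p_pr nf px k1.
(* In the symmetric case the class has two points, one on each level, so coprimality makes |HH|
   odd. *)
have odd_HH : symmetric_levels cls -> odd #|HH|.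
  move=> sy; move: co; rewrite (card_cls_symmetric cls_schur cls0 sy) ?k1.
    by rewrite coprime2n.
  by apply: contraNneq px => ->; rewrite dvdn0.
exists (wauts cls HH w w'); split; first exact: wauts_finite_aut_subgroup.
move=> f; have inv := wauts_invariant cls_schur HH_aut cls0 w1 w'1 cls_w odd_HH f.
split=> [/(in_spanP cls_schur cls_D D_cls) [fin /inv]|[fin /inv f_const]] //.
exact/(in_spanP cls_schur cls_D D_cls).
Qed.
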